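(* For every integer $d\geqslant 3$ there exist constants $C_d\geqslant 1$, $\tau>0$ and $B_d>0$, depending only on $d$, such that for every finite metric space $\mathcal{M}=(M,\varrho)$ with at least three points, setting $N:=|M|$, we have, for every integer $n\geqslant d$ with $dn$ even, $$\mathbb{P}_{G(n,d)}\Big[G\colon \gamma(G,\varrho)\leqslant C_d\min\big\{\log n,\ \log\log N\big\}\Big]\geqslant 1-\frac{B_d}{n^{\tau}}.$$
   Context: $G(n,d)$ denotes the set of all $d$-regular (simple) graphs on $[n]:=\{1,\dots,n\}$ and $\mathbb{P}_{G(n,d)}$ the uniform probability measure on $G(n,d)$; statements about $\mathbb{P}_{G(n,d)}$ are understood for those $n$ for which $G(n,d)\neq\emptyset$. $\log$ is the natural logarithm. For a $d$-regular graph $G$ with vertex set $V_G$ and edge set $E_G$, and a metric space $\mathcal{M}=(M,\varrho)$, $\gamma(G,\varrho)$ denotes the smallest constant $\gamma\in(0,\infty]$ such that for every $f\colon V_G\to M$, $$\frac{1}{|V_G|^2}\sum_{v,u\in V_G}\varrho\big(f(v),f(u)\big)\leqslant\frac{\gamma}{|E_G|}\sum_{\{v,u\}\in E_G}\varrho\big(f(v),f(u)\big),$$ where the left-hand sum is over all ordered pairs $(v,u)$. *)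

(* Defs.v *)
From HB Require Import structures.
From mathcomp Require Import all_boot all_order all_algebra.
From mathcomp Require Import all_classical all_reals all_analysis.

Set Implicit Arguments.
Unset Strict Implicit.
Unset Printing Implicit Defensive.

Import Order.TTheory GRing.Theory Num.Theory.

Local Open Scope classical_set_scope.
Local Open Scope ring_scope.

(* A graph on the vertex set 'I_n is given by its set of edges.  The vertices
   are numbered from 0 to n - 1 instead of from 1 to n. *)
Definition edge_set (n : nat) : finType := {set {set 'I_n}}.

Definition is_simple_graph (n : nat) (G : edge_set n) : bool :=
  [forall e in G, #|e| == 2].

Definition degree (n : nat) (G : edge_set n) (v : 'I_n) : nat :=
  #|[set e in G | v \in e]%SET|.

Definition regular_graphs (n d : nat) : {set edge_set n} :=
  [set G : edge_set n |
    is_simple_graph G && [forall v, degree G v == d]]%SET.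

(* Only meaningful when there is a d-regular graph on n vertices; the value is
   0 otherwise. *)
Definition regular_graph_prob (R : realType) (n d : nat)
    (A : pred (edge_set n)) : R :=
  #|[set G in regular_graphs n d | A G]%SET|%:R / #|regular_graphs n d|%:R.

Section poincare.
Context {R : realType} {M : metricType R} {n : nat}.

Definition mean_pair_dist (f : 'I_n -> M) : R :=
  (n%:R ^+ 2)^-1 * \sum_(v < n) \sum_(u < n) mdist (f v) (f u).

(* The condition v < u selects one ordered pair for each edge {v, u}. *)
Definition edge_dist_sum (G : edge_set n) (f : 'I_n -> M) : R :=
  \sum_(v < n) \sum_(u < n | (v < u)%N && ([set v; u]%SET \in G))
    mdist (f v) (f u).

Definition poincare_inequality (G : edge_set n) (g : R) : Prop :=
  forall f : 'I_n -> M,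
    mean_pair_dist f <= g / #|G|%:R * edge_dist_sum G f.

End poincare.

(* The infimum is +oo when no finite constant is admissible. *)
Definition poincare_const (R : realType) (M : metricType R) (n : nat)
    (G : edge_set n) : \bar R :=
  ereal_inf [set g%:E | g in [set g : R |
    0 < g /\ poincare_inequality (M := M) G g]].

(* Main.v *)
(* Call a d-regular graph an expander if every set of at most half of the
   vertices has proportionally many boundary edges.  Switching two edges so as
   to increase the boundary of a fixed set by two shows that a random regular
   graph is an expander with probability 1 - O(1/n).

   Let G be an expander and f a map into an N-point space with average edge
   length 1, and let m be of order log N (at most n/2).  Region growing shows
   that around most vertices the ball of radius L = O(log m), for the lengths
   induced on the edges, has at least m vertices; so about n/m roots and a
   forest of parent pointers assign to most vertices a root at distance O(L).
   If some ball of radius O(L) of the metric space contains a fixed fraction of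
   the values of f, the real Poincare inequality on the expander, applied to
   the distance to its centre, bounds the mean distance by O(L).  Otherwise
   most edges of G join vertices whose roots have values at distance O(L),
   although only a small fraction of all pairs does.  The labels of the n/m
   roots can be chosen in N^(n/m) = exp(O(n)) ways, and a switching argument
   shows that k given edges lie in G with probability at most (C/n)^k; a union
   bound over forests, labels and n/4 further edges shows that the second case
   has probability at most 2^-n.  If m is about n/2, a single ball of radius L
   is already large and the second case does not occur. *)

Require Import Defs.
From HB Require Import structures.
From mathcomp Require Import all_boot all_order all_algebra.
From mathcomp Require Import all_classical all_reals all_analysis.
From mathcomp Require Import zify ring lra.
From mathcomp Require Import fintype finset.

Set Implicit Arguments.
Unset Strict Implicit.
Unset Printing Implicit Defensive.

Import Order.TTheory GRing.Theory Num.Theory.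

Local Open Scope set_scope.
Local Open Scope nat_scope.

(** * Edges and boundaries *)

Definition adj n (G : edge_set n) (u v : 'I_n) : bool := [set u; v] \in G.

Definition boundary n (G : edge_set n) (A : {set 'I_n}) : nat :=
  \sum_(u in A) \sum_(v in ~: A) adj G u v.

(** The natural number [q] is the inverse of the edge expansion, so that the condition stays in the
    integers. *)
Definition expander n (q : nat) (G : edge_set n) : Prop :=
  forall A : {set 'I_n}, 2 * #|A| <= n -> #|A| <= q * boundary G A.

Lemma adjC n (G : edge_set n) u v : adj G u v = adj G v u.
Proof. by rewrite /adj setUC. Qed.

Lemma regularP n d (G : edge_set n) : reflect
  ((forall e, e \in G -> #|e| = 2) /\ (forall v, degree G v = d))
  (G \in regular_graphs n d).
Proof.
rewrite inE; apply: (iffP andP) => -[H1 H2]; split.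
- by move=> e eG; apply/eqP; move/forallP/(_ e)/implyP: H1; apply.
- by move=> v; apply/eqP; move/forallP: H2.
- by apply/forallP => e; apply/implyP => eG; rewrite H1.
- by apply/forallP => v; rewrite H2.
Qed.
Arguments regularP {n d G}.

Lemma adj_irr n d (G : edge_set n) u v :
  G \in regular_graphs n d -> adj G u v -> u != v.
Proof.
by case/regularP => s _ /s; rewrite cards2; case: eqP.
Qed.

Lemma sum_adj_degree n (G : edge_set n) u :
  (forall e, e \in G -> #|e| = 2) -> \sum_v adj G u v = degree G u.
Proof.
move=> s; have irr v w : adj G v w -> v != w.
  by move=> /s; rewrite cards2; case: eqP.
rewrite /degree -big_mkcond /= sum1dep_card.
rewrite -(@card_in_imset _ _ (fun v => [set u; v])).
  apply: eq_card => e; rewrite !inE; apply/imsetP/andP.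
    by case=> v; rewrite inE => uv ->; split; rewrite // set21.
  case=> eG ue; have /eqP/cards2P [x [y [xy exy]]] := s _ eG.
  move: ue; rewrite exy => /set2P [] ->.
    by exists y; rewrite // inE /adj -exy.
  by exists x; rewrite ?inE /adj setUC // -exy.
move=> v w; rewrite !inE => uv _ E.
have : v \in [set u; w] by rewrite -E set22.
by case/set2P => // vu; case/eqP: (irr _ _ uv).
Qed.

Lemma sum_adj_simple n (G : edge_set n) :
  (forall e, e \in G -> #|e| = 2) -> \sum_u \sum_v adj G u v = 2 * #|G|.
Proof.
move=> s; under eq_bigr => u _ do rewrite (sum_adj_degree _ s).
rewrite mulnC -sum_nat_const.
transitivity (\sum_(e in G) #|e|); last by apply: eq_bigr => e /s.
under [RHS]eq_bigr => e _ do rewrite -sum1_card.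
rewrite [RHS](exchange_big_dep predT) //=; apply: eq_bigr => v _.
by rewrite /degree -sum1dep_card; apply: eq_bigl => e.
Qed.

Lemma sum_adj n d (G : edge_set n) u :
  G \in regular_graphs n d -> \sum_v adj G u v = d.
Proof. by case/regularP => s dg; rewrite sum_adj_degree. Qed.

Lemma sum_adj_dn n d (G : edge_set n) :
  G \in regular_graphs n d -> \sum_u \sum_v adj G u v = d * n.
Proof.
move=> Gr; under eq_bigr => u _ do rewrite (sum_adj _ Gr).
by rewrite sum_nat_const card_ord mulnC.
Qed.

Lemma card_edges n d (G : edge_set n) :
  G \in regular_graphs n d -> 2 * #|G| = d * n.
Proof.
move=> Gr; rewrite -(sum_adj_dn Gr) sum_adj_simple //.
by case/regularP: Gr.
Qed.

Lemma boundary_setC n (G : edge_set n) (A : {set 'I_n}) :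
  boundary G (~: A) = boundary G A.
Proof.
rewrite /boundary setCK exchange_big; apply: eq_bigr => u _; apply: eq_bigr => v _.
by rewrite adjC.
Qed.

(** * Poincare inequality for integer-valued functions *)

Lemma sum_interval (a b T : nat) :
  \sum_(t < T) ((b <= t) && (t < a)) = minn a T - b.
Proof.
elim: T => [|T IH]; first by rewrite big_ord0; lia.
by rewrite big_ord_recr /= IH; case: (leqP b T); case: (ltnP T a) => /=; lia.
Qed.

(** A level set with more than half of the vertices is handled through its complement, which
    contains the zeros of [g] and so has at least n/s vertices; this costs the factor [s]. *)
Lemma boundary_level n q s (G : edge_set n) (g : 'I_n -> nat) t :
  expander q G -> 0 < s -> n <= s * #|[set v | g v == 0]| ->
  #|[set v | t < g v]| <= q * s * boundary G [set v | t < g v].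
Proof.
move=> Ge s0 Zn; set A := [set v | t < g v].
have ZA : #|[set v | g v == 0]| <= #|~: A|.
  by apply: subset_leq_card; apply/subsetP => v; rewrite !inE => /eqP ->.
have An : #|A| <= n by rewrite -[leqRHS]card_ord; apply: max_card.
have ACn : #|A| + #|~: A| = n by rewrite cardsC card_ord.
case: (leqP (2 * #|A|) n) => [/Ge AG|A2].
  by apply: leq_trans AG _; rewrite leq_mul ?leq_pmulr.
have : #|~: A| <= q * boundary G (~: A).
  apply: Ge; move: A2 ACn; set a := #|A|; set b := #|~: A| => A2 ACn.
  lia.
rewrite boundary_setC mulnAC => AG; apply: leq_trans An (leq_trans Zn _).
by rewrite mulnC leq_mul // (leq_trans ZA).
Qed.

(** Layer-cake formula: both sides are sums over thresholds t of the bound for the level set g > t.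
    Truncated subtraction counts each edge once, from its higher to its lower end. *)
Lemma l1_poincare n q s (G : edge_set n) (g : 'I_n -> nat) :
  expander q G -> 0 < s -> n <= s * #|[set v | g v == 0]| ->
  \sum_v g v <= q * s * \sum_u \sum_v adj G u v * (g u - g v).
Proof.
move=> Ge s0 Zn; pose T := \max_v g v.
have gT v : g v <= T by apply: leq_bigmax.
have -> : \sum_v g v = \sum_(t < T) #|[set v | t < g v]|.
  under [RHS]eq_bigr => t _ do rewrite -sum1dep_card big_mkcond.
  rewrite exchange_big; apply: eq_bigr => v _.
  transitivity (\sum_(t < T) ((0 <= t) && (t < g v))).
    by rewrite sum_interval subn0; apply/esym/minn_idPl.
  by apply: eq_bigr => t _; case: ltnP.
apply: (@leq_trans (\sum_(t < T) q * s * boundary G [set v | t < g v])).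
  by apply: leq_sum => t _; apply: boundary_level.
rewrite -big_distrr leq_mul2l; apply/orP; right.
have -> : \sum_u \sum_v adj G u v * (g u - g v) =
          \sum_(t < T) \sum_u \sum_v adj G u v * ((g v <= t) && (t < g u)).
  rewrite [RHS]exchange_big; apply: eq_bigr => u _.
  rewrite [RHS]exchange_big; apply: eq_bigr => v _.
  by rewrite -big_distrr sum_interval /= (minn_idPl (gT u)).
apply: leq_sum => t _; rewrite /boundary big_mkcond; apply: leq_sum => u _.
rewrite inE; case: ifP => // gu; rewrite big_mkcond; apply: leq_sum => v _.
by rewrite !inE -leqNgt; case: ifP => //; rewrite muln1.
Qed.

(** * Region growing *)

(** The volume used in region growing; each edge inside [U] contributes in both directions. *)
Definition potential n (G : edge_set n) (w : 'I_n -> 'I_n -> nat)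
    (U : {set 'I_n}) : nat :=
  #|U| + \sum_(u in U) \sum_(v in U) adj G u v * w u v.

Lemma potentialD n (G : edge_set n) w (U B : {set 'I_n}) : B \subset U ->
  #|B| + \sum_(u in B) \sum_(v in U) adj G u v * w u v + potential G w (U :\: B)
  <= potential G w U.
Proof.
move=> BU; rewrite /potential -(cardsID B U) (setIidPr BU).
rewrite [X in _ <= _ + X](big_setID B) /= (setIidPr BU).
set a := #|B|; set b := \sum_(u in B) _; set c := #|U :\: B|.
set e := \sum_(i in U :\: B) \sum_(v in U) _.
set f := \sum_(u in U :\: B) \sum_(v in U :\: B) _.
suff : f <= e by clearbody a b c e f; lia.
apply: leq_sum => u _; rewrite [leqRHS](big_setID B) /=; exact: leq_addl.
Qed.

Lemma boundary_split n (G : edge_set n) (U B : {set 'I_n}) : B \subset U ->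
  boundary G B = \sum_(u in B) \sum_(v in U :\: B) adj G u v
    + \sum_(u in B) \sum_(v in ~: U) adj G u v.
Proof.
move=> BU; rewrite -big_split; apply: eq_bigr => u _ /=.
rewrite (big_setID U) /=; congr (_ + _); apply: eq_bigl => v.
  by rewrite !inE andbC.
by rewrite !inE andbC; case: (boolP (v \in B)) => // /(subsetP BU) ->.
Qed.

Lemma boundaryD n (G : edge_set n) (U B : {set 'I_n}) : B \subset U ->
  boundary G (U :\: B) + \sum_(u in B) \sum_(v in ~: U) adj G u v
  = boundary G U + \sum_(u in B) \sum_(v in U :\: B) adj G u v.
Proof.
move=> BU; rewrite (@boundary_split _ _ U (U :\: B)) ?subsetDl //.
rewrite setDDr setDv set0U (setIidPr BU) /boundary [in RHS](big_setID B) /=.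
rewrite (setIidPr BU) [X in X + _ + _ = _]exchange_big /=.
rewrite addnAC [RHS]addnC addnA; congr (_ + _ + _).
by apply: eq_bigr => u _; apply: eq_bigr => v _; rewrite adjC.
Qed.

Definition shell n (G : edge_set n) (U : {set 'I_n}) (B : nat -> {set 'I_n})
    t : nat :=
  \sum_(u in U :&: B t) \sum_(v in U :\: B t) adj G u v.

(** Abstracts the balls around one centre for the edge lengths [w], indexed by the radius. *)
Definition ball_family n (G : edge_set n) (w : 'I_n -> 'I_n -> nat)
    (B : nat -> {set 'I_n}) : Prop :=
  (forall s t, s <= t -> B s \subset B t) /\
  (forall t u v, u \in B t -> adj G u v -> v \in B (t + w u v)).

(** If s0 is the first radius whose ball contains u, then v has entered by radius s0 + [w u v].
    Hence the edge is cut at no more than [w u v] radii. *)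
Lemma crossing_times n (G : edge_set n) w B u v t :
  ball_family G w B -> adj G u v ->
  \sum_(s < t) ((u \in B s) && (v \notin B s)) <= (u \in B t) * w u v.
Proof.
move=> [Bmono Bw] uv.
have [/existsP [s us]|] := boolP [exists s : 'I_t, u \in B s]; last first.
  move/existsPn => nu; rewrite big1 // => s _.
  by rewrite (negbTE (nu s)).
have -> : u \in B t by apply: subsetP us; apply/Bmono/ltnW.
rewrite mul1n; have ex : exists s, u \in B s by exists s.
case: (ex_minnP ex) => s0 us0 s0min.
apply: (@leq_trans (\sum_(s < t) ((s0 <= s) && (s < s0 + w u v)))).
  apply: leq_sum => i _; case: (boolP (u \in B i)) => //= ui.
  case: (boolP (v \in B i)) => //= vi; rewrite s0min //= ltnNge.
  case: leqP => // le; case/negP: vi.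
  by apply: subsetP (Bw _ _ _ us0 uv); apply: Bmono.
by rewrite sum_interval; lia.
Qed.

Lemma sum_shell n (G : edge_set n) w (U : {set 'I_n}) B t :
  ball_family G w B ->
  \sum_(s < t) shell G U B s
  <= \sum_(u in U :&: B t) \sum_(v in U) adj G u v * w u v.
Proof.
move=> Bb; rewrite /shell.
have -> : \sum_(s < t) \sum_(u in U :&: B s) \sum_(v in U :\: B s) adj G u v
  = \sum_(u in U) \sum_(v in U) \sum_(s < t)
     adj G u v * ((u \in B s) && (v \notin B s)).
  under [RHS]eq_bigr => u _ do rewrite exchange_big.
  rewrite [RHS]exchange_big; apply: eq_bigr => s _ /=.
  rewrite (eq_bigl (fun u => (u \in U) && (u \in B s))); last first.
    by move=> u; rewrite inE.
  rewrite big_mkcondr; apply: eq_bigr => u _; case: (u \in B s) => /=.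
    rewrite (eq_bigl (fun v => (v \in U) && (v \notin B s))); last first.
      by move=> v; rewrite inE andbC.
    rewrite big_mkcondr; apply: eq_bigr => v _.
    by case: (v \notin B s); rewrite ?muln1 ?muln0.
  by rewrite big1 // => v _; rewrite muln0.
rewrite [leqRHS](eq_bigl (fun u => (u \in U) && (u \in B t))); last first.
  by move=> u; rewrite inE.
rewrite big_mkcondr; apply: leq_sum => u _.
apply: (@leq_trans (\sum_(v in U) (u \in B t) * (adj G u v * w u v))).
  apply: leq_sum => v _; rewrite -big_distrr /=.
  case: (boolP (adj G u v)) => uv; last by rewrite mul0n.
  by rewrite /= !mul1n; apply: crossing_times uv.
by rewrite -big_distrr /=; case: (u \in B t); rewrite ?mul1n ?mul0n.
Qed.

(** If every radius below [R] failed, each step would multiply 1 plus the accumulated shells by at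
    least (p+1)/p. But the shells below [R] sum to at most R d m, so the last hypothesis rules this
    out. *)
Lemma good_radius n d (G : edge_set n) (U : {set 'I_n})
    (B : nat -> {set 'I_n}) x p m R :
  G \in regular_graphs n d -> (forall s t, s <= t -> B s \subset B t) ->
  x \in U -> x \in B 0 -> #|B R| <= m ->
  p ^ R * (1 + R * (d * m)) < p.+1 ^ R ->
  exists2 t, t < R &
    p * shell G U B t <= #|U :&: B t| + \sum_(s < t) shell G U B s.
Proof.
move=> Gr Bmono xU xB Bm growth.
have [/existsP [t Ht]|] := boolP [exists t : 'I_R,
    p * shell G U B t <= #|U :&: B t| + \sum_(s < t) shell G U B s].
  by exists t.
move/existsPn => H; exfalso; move: growth; apply/negP; rewrite -leqNgt.
have grow t : t <= R -> p.+1 ^ t <= p ^ t * (1 + \sum_(s < t) shell G U B s).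
  elim: t => [|t IH] tR; first by rewrite big_ord0.
  have := IH (ltnW tR); have := H (Ordinal tR); rewrite -ltnNge /=.
  have : 0 < #|U :&: B t|.
    apply/card_gt0P; exists x; rewrite inE xU /=.
    by apply: subsetP xB; apply: Bmono.
  rewrite big_ord_recr /= !expnS; set W := \sum_(s < t) _.
  move: (shell G U B t) (#|_|) (p ^ t) (p.+1 ^ t) => sh b pt pt1 b0 Hs IH'.
  apply: (@leq_trans (p.+1 * (pt * (1 + W)))); first by rewrite leq_mul.
  rewrite mulnCA [leqRHS]mulnAC [leqRHS]mulnC leq_mul //; lia.
apply: leq_trans (grow R (leqnn _)) _.
rewrite leq_mul2l leq_add2l; apply/orP; right.
rewrite -[leqRHS]mulnC -[X in _ <= _ * X]card_ord mulnC -sum_nat_const.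
apply: leq_sum => t _; apply: leq_trans (_ : d * #|U :&: B t| <= _).
  rewrite mulnC -sum_nat_const; apply: leq_sum => u _.
  by rewrite -(sum_adj u Gr) [leqRHS](bigID (mem (U :\: B t))) leq_addr.
rewrite leq_mul2l (leq_trans _ Bm) ?orbT // subset_leq_card //.
by apply: (subset_trans (subsetIr _ _)); apply: Bmono; apply: ltnW.
Qed.

(* Region growing: around a vertex with a small ball there is a radius at which
   few edges leave the ball, compared with its size and the weight inside it.
   Removing such balls one after another cuts few edges in total, whereas an
   expander forces each ball to have many boundary edges. *)
Lemma poor_vertices_in n d q (G : edge_set n) w
    (B : 'I_n -> nat -> {set 'I_n}) p m R (U : {set 'I_n}) :
  G \in regular_graphs n d -> expander q G ->
  (forall x, x \in B x 0) -> (forall x, ball_family G w (B x)) -> 2 * m <= n ->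
  p ^ R * (1 + R * (d * m)) < p.+1 ^ R ->
  p * #|[set x in U | #|B x R| < m]|
  <= q * (p * boundary G U + 2 * potential G w U).
Proof.
move=> Gr Ge B0 Bf mn growth; move: {2}(#|U|) (leqnn #|U|) => k.
elim: k U => [|k IH] U Uk.
  move: Uk; rewrite leqn0 cards_eq0 => /eqP ->.
  by rewrite (_ : [set x in _ | _] = set0) ?cards0 ?muln0 //; apply/setP => x;
    rewrite !inE.
have [->|[x]] := set_0Vmem [set x in U | #|B x R| < m].
  by rewrite cards0 muln0.
rewrite inE => /andP [xU xP]; have [Bmono _] := Bf x.
have [t tR Ht] := good_radius Gr Bmono xU (B0 x) (ltnW xP) growth.
set C := U :&: B x t; have CU : C \subset U by apply: subsetIl.
have CxR : #|C| <= #|B x R|.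
  apply: subset_leq_card; apply: (subset_trans (subsetIr _ _)).
  by apply: Bmono; apply: ltnW.
have UC : U :\: C = U :\: B x t by rewrite /C setDIr setDv set0U.
have CG : #|C| <= q * boundary G C.
  apply: Ge; apply: leq_trans mn; rewrite leq_mul2l /=.
  by apply: leq_trans CxR (ltnW xP).
have xC : x \in C by rewrite inE xU; apply: subsetP (B0 x); apply: Bmono.
have /IH IHU : #|U :\: C| <= k.
  move: Uk; rewrite -(cardsID C U) (setIidPr CU).
  have : 0 < #|C| by apply/card_gt0P; exists x.
  by move: #|C| #|U :\: C| => a b; lia.
have le1 : #|[set x in U | #|B x R| < m]|
    <= #|C| + #|[set x in U :\: C | #|B x R| < m]|.
  apply: leq_trans (leq_card_setU _ _); apply: subset_leq_card.
  by apply/subsetP => y; rewrite !inE => /andP [-> ->]; case: (y \in B x t).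
have := sum_shell U t (Bf x); have := potentialD G w CU.
have := boundaryD G CU; move: CG; rewrite (boundary_split G CU) UC.
have -> : \sum_(u in C) \sum_(v in U :\: B x t) adj G u v = shell G U (B x) t.
  by [].
move: IHU Ht le1; rewrite UC -/C.
set a1 := #|_|; set a2 := #|_|; set a3 := #|_|.
set c1 := boundary _ _; set p1 := potential _ _ _; set c2 := boundary _ _.
set p2 := potential _ _ _; set W := \sum_(s < t) _; set E := \sum_(u in C) _.
set F := \sum_(u in C) _; set sh := shell _ _ _ _.
clearbody a1 a2 a3 c1 c2 p1 p2 W E F sh.
(* The shell enters twice, once through the expansion of [C] and once through the new boundary of
   [U :\: C]. Each time [p * sh] is at most [a3 + W], which the drop [p2 - p1] of the potential
   covers; hence the factor 2. *)
move=> h1 h2 h3 h4 h5 h6 h7.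
have := leq_mul (leqnn p) h3; have := leq_mul (leqnn p) h4 => h8 h9.
have h10 : p * sh + (p * E + p * c1) + 2 * p1 <= p * c2 + 2 * p2.
  have : p * (c1 + E) = p * (c2 + sh) by rewrite h5.
  by rewrite !mulnDr; lia.
have h11 := leq_mul (leqnn q) h10; lia.
Qed.

(** * Walks, nets and parent pointers *)

Lemma bernoulli_nat x l : 1 + x * l <= (1 + x) ^ l.
Proof.
elim: l => [|l IH]; first by rewrite muln0.
by rewrite expnS; apply: leq_trans (leq_mul (leqnn _) IH); rewrite mulnS; nia.
Qed.

(** A radius proportional to [l], hence to log m, is enough: ((p+1)/p)^(p s) >= 2^s, and with s =
    (4pd + 1) l this exceeds the factor 1 + R d m, where m <= 2^l. *)
Lemma growth_radius p d : 0 < p -> exists2 k, 0 < k & forall l m,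
  0 < l -> m <= 2 ^ l ->
  p ^ (p * k * l) * (1 + p * k * l * (d * m)) < p.+1 ^ (p * k * l).
Proof.
move=> p0; pose c := p * d; exists (4 * c).+1 => // l m l0 ml.
set s := (4 * c).+1 * l; rewrite -mulnA -/s.
have two_s : 2 ^ s * p ^ (p * s) <= p.+1 ^ (p * s).
  rewrite !(expnM _ p) -expnMn leq_exp2r; last by rewrite muln_gt0.
  (* Bernoulli's inequality for (1 + 1/p)^j with denominators cleared; j = p gives the factor 2. *)
  have bern j : p ^ j * (p + j) <= p * p.+1 ^ j.
    elim: j => [|j IH]; first by rewrite addn0 mulnC.
    rewrite !expnS mulnCA; apply: leq_trans (leq_mul (leqnn p.+1) IH).
    by move: (p ^ j) => e; nia.
  rewrite -(leq_pmul2l p0); apply: leq_trans (bern p).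
  by rewrite addnn -mul2n; lia.
rewrite mulnC; apply: leq_trans two_s.
rewrite ltn_pmul2r ?expn_gt0 ?p0 //.
have -> : 2 ^ s = 2 ^ l * (2 ^ (4 * c)) ^ l by rewrite -expnM -expnD /s mulSn.
have k_large : 1 + c * (4 * c).+1 <= 2 ^ (4 * c).
  have := ltn_expl (2 * c) (ltnSn 1); set e := 2 ^ _ => ce.
  have -> : 2 ^ (4 * c) = e * e by rewrite -expnD; congr (_ ^ _); lia.
  by apply: leq_trans (leq_mul ce ce); nia.
have : 1 + c * (4 * c).+1 * l <= (2 ^ (4 * c)) ^ l.
  apply: leq_trans (bernoulli_nat _ _) _; case: l l0 {ml s} => // l _.
  by rewrite leq_exp2r.
have : 2 <= 2 ^ l by rewrite -{1}(expn1 2) leq_exp2l.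
move: ml; rewrite /s /c; move: (2 ^ l) (_ ^ l) => a b; nia.
Qed.

Inductive walk n (G : edge_set n) (w : 'I_n -> 'I_n -> nat) (x : 'I_n) :
    'I_n -> nat -> Prop :=
| walk0 : walk G w x x 0
| walkS u v t : walk G w x u t -> adj G u v -> walk G w x v (t + w u v).

Definition wball n (G : edge_set n) (w : 'I_n -> 'I_n -> nat) (x : 'I_n)
    (t : nat) : {set 'I_n} :=
  [set v | `[< exists2 s, s <= t & walk G w x v s >]].

Lemma wballP n (G : edge_set n) w x t v :
  reflect (exists2 s, s <= t & walk G w x v s) (v \in wball G w x t).
Proof. by rewrite inE; apply: asboolP. Qed.

Lemma walk_trans n (G : edge_set n) w x y z s t :
  walk G w x y s -> walk G w y z t -> walk G w x z (s + t).
Proof.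
move=> xy; elim=> [|u v r _ IH uv]; first by rewrite addn0.
by rewrite addnA; apply: walkS.
Qed.

Lemma walk_sym n (G : edge_set n) w x y t : (forall u v, w u v = w v u) ->
  walk G w x y t -> walk G w y x t.
Proof.
move=> ws; elim=> [|u v r _ IH uv]; first exact: walk0.
rewrite addnC; apply: walk_trans IH; rewrite ws -[w v u]add0n.
by apply: walkS; [exact: walk0|rewrite adjC].
Qed.

Lemma wball_center n (G : edge_set n) w x t : x \in wball G w x t.
Proof. by apply/wballP; exists 0 => //; apply: walk0. Qed.

Lemma wball_family n (G : edge_set n) w x : ball_family G w (wball G w x).
Proof.
split=> [s t st|t u v /wballP [s st xu] uv].
  by apply/subsetP => v /wballP [r rs xv]; apply/wballP; exists r => //; lia.
by apply/wballP; exists (s + w u v); [lia|apply: walkS].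
Qed.

(** [S] is a maximal set of centres whose [R]-balls are pairwise disjoint and have at least [m]
    vertices. Disjointness bounds its size; by maximality every other such ball meets one of them,
    so its centre is within 2R of [S]. *)
Lemma wball_net n (G : edge_set n) w m R : (forall u v, w u v = w v u) ->
  exists2 S : {set 'I_n}, #|S| * m <= n &
    forall x, m <= #|wball G w x R| ->
      exists2 s, s \in S & x \in wball G w s (2 * R).
Proof.
move=> ws; pose P (S : {set 'I_n}) := [forall x in S, m <= #|wball G w x R|] &&
  [forall x in S, forall y in S,
    (x != y) ==> [disjoint wball G w x R & wball G w y R]].
have P0 : P set0.
  by apply/andP; split; apply/forallP => x; rewrite inE.
have [S /maxsetP [/andP [/forall_inP rich /forall_inP disj] Smax]] :=
  ex_maxset (ex_intro P _ P0).
have disjS x y : x \in S -> y \in S -> x != y ->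
    [disjoint wball G w x R & wball G w y R].
  by move=> xS yS; move/forall_inP: (disj _ xS) => /(_ _ yS) /implyP.
exists S => [|x xr].
- apply: (@leq_trans (\sum_(s in S) #|wball G w s R|)).
    by rewrite -sum_nat_const; apply: leq_sum => s /rich.
  under eq_bigr => s _ do rewrite -sum1_card big_mkcond.
  rewrite exchange_big -[leqRHS]card_ord -sum1_card; apply: leq_sum => v _ /=.
  rewrite -big_mkcondr sum1dep_card -cardsE; apply/card_le1_eqP => x y.
  rewrite !inE => /andP [xS vx] /andP [yS vy]; apply: contraTeq isT.
  rewrite eq_sym => xy.
  have vx' : v \in wball G w x R by move: vx; rewrite ?inE.
  have : v \in wball G w y R by move: vy; rewrite ?inE.
  by rewrite (disjointFr (disjS x y xS yS xy) vx').
- have [xS|xS] := boolP (x \in S); first by exists x => //; apply: wball_center.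
  have [/exists_inP [s sS ns]|] :=
      boolP [exists s in S, ~~ [disjoint wball G w x R & wball G w s R]].
    exists s => //; move: ns; rewrite -setI_eq0 => /set0Pn [v].
    rewrite inE => /andP [/wballP [a aR xv] /wballP [b bR sv]].
    apply/wballP; exists (b + a); first lia.
    by apply: walk_trans sv (walk_sym ws xv).
  move=> /exists_inPn nx; case/negP: xS; rewrite -(Smax (x |: S)) ?setU11 //.
    apply/andP; split; apply/forall_inP => y.
      by case/setU1P => [->|/rich].
    move=> yS; apply/forall_inP => z zS; apply/implyP.
    case/setU1P: yS => [->|yS]; case/setU1P: zS => [->|zS].
    + by rewrite eqxx.
    + by move=> _; apply/negPn/nx.
    + by move=> _; rewrite disjoint_sym; apply/negPn/nx.
    + exact: disjS.
  exact: subsetU1.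
Qed.

(** The set reachable from [x] has no boundary edges. Being nonempty, it has more than half of the
    vertices by expansion, and then its complement is empty, again by expansion. *)
Lemma expander_connected n q (G : edge_set n) w x v :
  expander q G -> exists t, walk G w x v t.
Proof.
move=> Ge; pose A := [set u | `[< exists t, walk G w x u t >]].
have inA u : reflect (exists t, walk G w x u t) (u \in A).
  by rewrite inE; apply: asboolP.
have cut0 : boundary G A = 0.
  rewrite /boundary big1 // => y /inA [t xy]; rewrite big1 // => z.
  rewrite inE => zA; case: (boolP (adj G y z)) => // yz; case/negP: zA.
  by apply/inA; exists (t + w y z); apply: walkS.
have xA : x \in A by apply/inA; exists 0; apply: walk0.
have A0 : 0 < #|A| by apply/card_gt0P; exists x.
have := cardsC A; rewrite card_ord => cA.
have A2 : n < 2 * #|A|.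
  by rewrite ltnNge; apply/negP => /Ge; rewrite cut0 muln0 leqNgt A0.
have AC : #|~: A| <= q * boundary G (~: A).
  apply: Ge; move: A2 cA; set a := #|A|; set b := #|~: A|; clearbody a b; lia.
apply/inA; rewrite -[A]setCK inE; apply/negP => vA.
move: AC; rewrite boundary_setC cut0 muln0 leqn0 => /eqP/cards0_eq E.
by move: vA; rewrite E inE.
Qed.

(** [D] is the distance to [S], and [pi v] is the last vertex before [v] on a shortest walk from
    [S]. *)
Lemma parents n q (G : edge_set n) w (S : {set 'I_n}) :
  expander q G -> S != set0 ->
  exists (D : 'I_n -> nat) (pi : {ffun 'I_n -> 'I_n}),
  [/\ forall v, v \in S -> pi v = v,
      forall v, v \notin S -> adj G (pi v) v /\ D (pi v) + w (pi v) v <= D v &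
      forall s t v, s \in S -> v \in wball G w s t -> D v <= t].
Proof.
move=> Ge /set0Pn [s0 s0S].
pose dist v t := `[< exists2 s, s \in S & walk G w s v t >].
have ex v : exists t, dist v t.
  have [t st] := expander_connected w s0 v Ge.
  by exists t; apply/asboolP; exists s0.
pose D v := ex_minn (ex v).
have Dle v s t : s \in S -> walk G w s v t -> D v <= t.
  rewrite /D; case: ex_minnP => r _ rmin sS sv.
  by apply: rmin; apply/asboolP; exists s.
have par v : exists u, (v \in S -> u = v) /\
    (v \notin S -> adj G u v /\ D u + w u v <= D v).
  have [vS|vS] := boolP (v \in S); first by exists v.
  have [s sS] : exists2 s, s \in S & walk G w s v (D v).
    by rewrite /D; case: ex_minnP => r /asboolP.
  move E : (D v) => t sv; case: sv vS E => [|u y r su uy vS E].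
    by rewrite sS.
  exists u; split=> // _; split=> //.
  by rewrite leq_add2r; apply: Dle su.
have {par} [f fP] := choice par.
exists D, [ffun v => f v]; split=> [v vS|v vS|s t v sS /wballP [r rt sv]].
- by rewrite ffunE; apply: (fP v).1.
- by rewrite ffunE; apply: (fP v).2.
- exact: leq_trans (Dle _ _ _ sS sv) rt.
Qed.

(** * Switchings *)

Definition switch n (G : edge_set n) (a b c e : 'I_n) : edge_set n :=
  [set a; c] |: ([set b; e] |: (G :\ [set a; b] :\ [set c; e])).

Definition switchable n (G : edge_set n) (a b c e : 'I_n) : bool :=
  [&& adj G a b, adj G c e, a != c, b != e, ~~ adj G a c & ~~ adj G b e].

Lemma set2_eq (T : finType) (x y z t : T) :
  ([set x; y] == [set z; t]) =
  ((x == z) && (y == t)) || ((x == t) && (y == z)).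
Proof.
apply/eqP/orP => [E|[] /andP [/eqP -> /eqP ->] //]; last by rewrite setUC.
have /set2P xE : x \in [set z; t] by rewrite -E set21.
have /set2P yE : y \in [set z; t] by rewrite -E set22.
have /set2P zE : z \in [set x; y] by rewrite E set21.
have /set2P tE : t \in [set x; y] by rewrite E set22.
have [xz|xz] := eqVneq x z.
  case: yE => [yz|->]; last by left; rewrite eqxx.
  by case: tE => ->; rewrite yz xz !eqxx; left.
case: xE => xE'; first by rewrite xE' eqxx in xz.
case: zE => zE'; first by rewrite zE' eqxx in xz.
by rewrite xE' zE' !eqxx; right.
Qed.

Lemma switch_edges n d (G : edge_set n) a b c e :
  G \in regular_graphs n d -> switchable G a b c e ->
  [/\ [set c; e] \in G :\ [set a; b],
      [set b; e] \notin G :\ [set a; b] :\ [set c; e] &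
      [set a; c] \notin [set b; e] |: (G :\ [set a; b] :\ [set c; e])].
Proof.
move=> Gr /and5P [ab ce ac be /andP [nac nbe]].
have abn := adj_irr Gr ab; have cen := adj_irr Gr ce.
have cb : c != b by apply: contraNneq nac => ->.
have ea : e != a by apply: contraNneq nbe => ->; rewrite adjC.
rewrite /adj in ce nac nbe.
rewrite !inE !set2_eq ce (negbTE nac) (negbTE nbe) !andbF !orbF /=.
rewrite (negbTE abn) ?[c == a]eq_sym (negbTE ac) (negbTE cb) /= andbF.
by split.
Qed.

(** With the indicator of containing a given vertex for [h], this shows that switching preserves
    degrees. *)
Lemma switch_sum n d (G : edge_set n) a b c e (h : {set 'I_n} -> nat) :
  G \in regular_graphs n d -> switchable G a b c e ->
  \sum_(x in switch G a b c e) h x + (h [set a; b] + h [set c; e])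
  = \sum_(x in G) h x + (h [set a; c] + h [set b; e]).
Proof.
move=> Gr sw; have [ce be ac] := switch_edges Gr sw.
rewrite /switch (big_setU1 _ ac) (big_setU1 _ be) /=.
have ab : [set a; b] \in G by case/and5P: sw.
rewrite [\sum_(x in G) _](big_setD1 _ ab) (big_setD1 _ ce) /=.
by move: (h _) (h _) (h _) (h _) (\sum_(i in _) _) => p q r s t; lia.
Qed.

Lemma switch_regular n d (G : edge_set n) a b c e :
  G \in regular_graphs n d -> switchable G a b c e ->
  switch G a b c e \in regular_graphs n d.
Proof.
move=> Gr sw; have [s dg] := regularP Gr.
have /and5P [ab ce ac be _] := sw.
apply/regularP; split=> [x|v].
  rewrite !inE => /orP [/eqP ->|/orP [/eqP ->|/and3P [_ _ /s] //]].
    by rewrite cards2 ac.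
  by rewrite cards2 be.
have degE H : degree H v = \sum_(x in H) (v \in x).
  rewrite /degree -sum1dep_card [RHS]big_mkcond [LHS]big_mkcond /=.
  by apply: eq_bigr => x _; case: (x \in H) => //=; case: (v \in x).
have := switch_sum (fun x => v \in x) Gr sw; rewrite -!degE dg.
have in2 x y : x != y -> (v \in [set x; y]) = (v == x) + (v == y) :> nat.
  by rewrite !inE; case: (v =P x) => //= -> /negbTE ->.
rewrite !in2 ?(adj_irr Gr ab) ?(adj_irr Gr ce) //; lia.
Qed.

Lemma switchK n d (G : edge_set n) a b c e :
  G \in regular_graphs n d -> switchable G a b c e ->
  switch (switch G a b c e) a c b e = G.
Proof.
move=> Gr sw; have [ce be ac] := switch_edges Gr sw.
have /and5P [ab ceG _ _ /andP [nac nbe]] := sw.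
rewrite /switch; apply/setP => x; rewrite !inE.
have [->|xab] := eqVneq x [set a; b]; first by rewrite -[LHS]/true; apply/esym.
have [->|xce] := eqVneq x [set c; e]; first by apply/esym.
have [->|xac] /= := eqVneq x [set a; c].
  by rewrite andbF; apply/esym/negbTE.
by have [->|xbe] //= := eqVneq x [set b; e]; apply/esym/negbTE.
Qed.

Lemma card_pairs (I J : finType) (P : I -> J -> bool) :
  \sum_i #|[set j | P i j]| = #|[set p : I * J | P p.1 p.2]|.
Proof.
rewrite -sum1dep_card [RHS]big_mkcond.
rewrite -(pair_bigA _ (fun i j => if P i j then 1 else 0)) /=.
by apply: eq_bigr => i _; rewrite -sum1dep_card [LHS]big_mkcond.
Qed.

(** Switching while remembering the four vertices is injective, since the switching at (a, c, b, e)
    undoes the one at (a, b, c, e). All double counts below are instances. *)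
Lemma switch_count n d (P Q : edge_set n -> 'I_n -> 'I_n -> 'I_n -> 'I_n -> bool) :
  (forall G a b c e, P G a b c e -> [/\ G \in regular_graphs n d,
    switchable G a b c e & Q (switch G a b c e) a b c e]) ->
  \sum_G \sum_a \sum_b \sum_c \sum_e P G a b c e <=
  \sum_G \sum_a \sum_b \sum_c \sum_e Q G a b c e.
Proof.
move=> H.
have sum_card (S : edge_set n -> 'I_n -> 'I_n -> 'I_n -> 'I_n -> bool) :
    \sum_G \sum_a \sum_b \sum_c \sum_e S G a b c e =
    #|[set p : edge_set n * ('I_n * ('I_n * ('I_n * 'I_n))) |
       S p.1 p.2.1 p.2.2.1 p.2.2.2.1 p.2.2.2.2]|.
  apply: etrans (card_pairs (fun G t => S G t.1 t.2.1 t.2.2.1 t.2.2.2)).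
  apply: eq_bigr => G _.
  apply: etrans (card_pairs (fun a t => S G a t.1 t.2.1 t.2.2)).
  apply: eq_bigr => a _; apply: etrans (card_pairs (fun b t => S G a b t.1 t.2)).
  apply: eq_bigr => b _; apply: etrans (card_pairs (S G a b)).
  apply: eq_bigr => c _.
  by rewrite -sum1dep_card [RHS]big_mkcond; apply: eq_bigr => e _; case: S.
rewrite !sum_card.
pose f (p : edge_set n * ('I_n * ('I_n * ('I_n * 'I_n)))) :=
  (switch p.1 p.2.1 p.2.2.1 p.2.2.2.1 p.2.2.2.2, p.2).
rewrite -(@card_in_imset _ _ f).
  apply: subset_leq_card; apply/subsetP => _ /imsetP [p + ->].
  by rewrite !inE /f /= => /H [].
move=> [G [a [b [c e]]]] [G' [a' [b' [c' e']]]].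
rewrite !inE /f /= => /H [Gr sw _] /H [Gr' sw' _] [E Ea Eb Ec Ee].
subst a' b' c' e'; congr (_, _).
by rewrite -(switchK Gr sw) E (switchK Gr' sw').
Qed.

Lemma sum_singletons (I : finType) (u v : I) (F : I -> I -> bool) :
  \sum_a \sum_b \sum_c \sum_e (((a == u) && (b == v)) && F c e) =
  \sum_c \sum_e F c e.
Proof.
rewrite (bigD1 u) //= (bigD1 v) //= !eqxx /= -[RHS]addn0 -addnA; congr (_ + _).
rewrite !big1 // => [a /negbTE ->|b /negbTE ->] /=.
  by rewrite big1 // => b _; rewrite big1 // => c _; rewrite big1.
by rewrite big1 // => c _; rewrite big1.
Qed.

Lemma sum_adj_point n d (G : edge_set n) u :
  G \in regular_graphs n d -> \sum_c \sum_e ((c == u) && adj G c e) = d.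
Proof.
move=> Gr; rewrite (bigD1 u) //= eqxx /= [X in _ + X]big1 ?addn0 ?sum_adj //.
  by rewrite (sum_adj _ Gr).
by move=> c /negbTE ->; rewrite big1.
Qed.

Lemma sum_adj_path n d (G : edge_set n) u :
  G \in regular_graphs n d -> \sum_c \sum_e (adj G u c && adj G c e) = d * d.
Proof.
move=> Gr; transitivity (\sum_c adj G u c * d).
  apply: eq_bigr => c _; case: (adj G u c); last by rewrite big1.
  by rewrite mul1n -(sum_adj c Gr); apply: eq_bigr.
by rewrite -big_distrl /= (sum_adj _ Gr).
Qed.

(** * Probability of containing prescribed edges *)

Definition supergraphs n d (X : edge_set n) : {set edge_set n} :=
  [set G in regular_graphs n d | X \subset G].

(** Double count of the switchings that destroy the edge uv but keep [X]. Almost every edge ce can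
    serve as partner, whereas a resulting graph arises in at most d^2 ways, from a neighbour c of u
    and a neighbour e of v. *)
Lemma supergraphs_step n d (X : edge_set n) u v :
  [set u; v] \notin X ->
  #|supergraphs d ([set u; v] |: X)| * (d * n - 2 * #|X|.+1 - 2 * (d + d * d))
  <= #|supergraphs d X| * (d * d).
Proof.
move=> uvX; set Y := [set u; v] |: X.
pose P (G : edge_set n) (a b c e : 'I_n) :=
  ((a == u) && (b == v)) && ((G \in supergraphs d Y) && [&& adj G c e,
    ~~ adj Y c e, u != c, v != e, ~~ adj G u c & ~~ adj G v e]).
pose Q (G : edge_set n) (a b c e : 'I_n) := ((a == u) && (b == v)) &&
  ((G \in supergraphs d X) && (adj G u c && adj G v e)).
have PQ (G : edge_set n) a b c e : P G a b c e -> [/\ G \in regular_graphs n d,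
    switchable G a b c e & Q (switch G a b c e) a b c e].
  move=> /andP [/andP [/eqP -> /eqP ->] /andP [GY /and5P [ce nY uc ve]]].
  move=> /andP [nuc nve]; move: (GY); rewrite inE => /andP [Gr YG].
  have uv : adj G u v by apply: (subsetP YG); rewrite setU11.
  have sw : switchable G u v c e by apply/and5P; split=> //; apply/andP; split.
  split=> //; rewrite /Q !eqxx inE switch_regular //= /adj /switch.
  rewrite setU11 /= !inE eqxx orbT andbT; apply/subsetP => x xX.
  rewrite !inE (subsetP YG) ?inE ?xX ?orbT // andbT.
  apply/orP; right; apply/orP; right; apply/andP; split.
    by apply: contraNneq nY => E; rewrite /adj -E setU1r.
  by apply: contraNneq uvX => <-.
have := switch_count PQ.
under eq_bigr => G _ do rewrite sum_singletons.
under [X in _ <= X -> _]eq_bigr => G _ do rewrite sum_singletons.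
move=> PQle.
apply: (@leq_trans (\sum_G \sum_c \sum_e ((G \in supergraphs d Y) &&
    [&& adj G c e, ~~ adj Y c e, u != c, v != e, ~~ adj G u c & ~~ adj G v e]))).
  rewrite -sum_nat_const big_mkcond; apply: leq_sum => G _.
  have [GY|//] /= := boolP (G \in _); move: GY; rewrite inE => /andP [Gr YG].
  have Ys x : x \in Y -> #|x| = 2.
    by have [s _] := regularP Gr => xY; apply/s/(subsetP YG).
  have cY : #|Y| <= #|X|.+1 by rewrite cardsU1; case: (_ \notin _).
  rewrite leq_subLR leq_subLR -(sum_adj_dn Gr).
  (* Of the dn ordered edges (c, e), those in [Y] number at most 2(|X|+1); those with c = u or e = v
     number d each; those with c adjacent to u or e adjacent to v number d^2 each. *)
  apply: (@leq_trans (\sum_c \sum_e adj Y c e +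
      ((\sum_c \sum_e ((c == u) && adj G c e) +
        \sum_c \sum_e ((c == v) && adj G c e)) +
      (\sum_c \sum_e (adj G u c && adj G c e) +
       \sum_c \sum_e (adj G v c && adj G c e)) +
      \sum_c \sum_e [&& adj G c e, ~~ adj Y c e, u != c, v != e,
                      ~~ adj G u c & ~~ adj G v e]))); last first.
    rewrite (sum_adj_simple Ys) !(sum_adj_point _ Gr) !(sum_adj_path _ Gr).
    move: cY; set y := #|Y|; set x := #|X|; set s := \sum_c _.
    clearbody y x s; lia.
  rewrite [\sum_c \sum_e ((c == v) && _)]exchange_big.
  rewrite [\sum_c \sum_e (adj G v c && _)]exchange_big.
  rewrite -!big_split; apply: leq_sum => c _ /=.
  rewrite -!big_split; apply: leq_sum => e _ /=.
  rewrite [u == c]eq_sym [v == e]eq_sym [adj G e c]adjC.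
  by case: (adj G c e) (adj Y c e) (c == u) (e == v) (adj G u c) (adj G v e)
    => [] [] [] [] [] [].
apply: leq_trans PQle _; rewrite -sum_nat_const [leqRHS]big_mkcond.
apply: leq_sum => G _; have [GX|_] := boolP (G \in _) => /=; last first.
  by rewrite big1 // => c _; rewrite big1.
have /andP [Gr _] : (G \in regular_graphs n d) && (X \subset G).
  by move: GX; rewrite inE.
rewrite -{1}(sum_adj u Gr) big_distrl; apply: leq_sum => c _ /=.
rewrite -(sum_adj v Gr) big_distrr; apply: leq_sum => e _ /=.
by case: (adj G u c) (adj G v e) => [] [].
Qed.

(** The edges of [Y] are removed one at a time; [D] bounds the number of partners from below at
    every stage, so each edge costs a factor d^2/D. *)
Lemma card_supergraphs n d (Y : edge_set n) (D : nat) :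
  D + 2 * #|Y| + 2 * (d + d * d) <= d * n ->
  (forall e, e \in Y -> #|e| = 2) ->
  #|supergraphs d Y| * D ^ #|Y| <= #|regular_graphs n d| * (d * d) ^ #|Y|.
Proof.
move: {2}#|Y| (erefl #|Y|) => k; elim: k Y => [|k IH] Y Yk Dle Ys.
  rewrite Yk !muln1; apply: subset_leq_card.
  by apply/subsetP => G; rewrite inE => /andP [].
have [e eY] : exists e, e \in Y by apply/set0Pn; rewrite -card_gt0 Yk.
have /eqP/cards2P [u [v [uv ee]]] := Ys _ eY.
have Xk : #|Y :\ e| = k by have := cardsD1 e Y; rewrite eY Yk => -[].
have EY : Y = [set u; v] |: (Y :\ e) by rewrite -ee setD1K.
have nX : [set u; v] \notin Y :\ e by rewrite ee setD11.
have H1 := supergraphs_step d nX; rewrite -EY Xk in H1.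
have H2 : #|supergraphs d (Y :\ e)| * D ^ k <= #|regular_graphs n d| * (d * d) ^ k.
  rewrite -Xk; apply: IH => //; first by rewrite Xk; rewrite Yk in Dle; lia.
  by move=> x /setD1P [_ /Ys].
have DD : D <= d * n - 2 * k.+1 - 2 * (d + d * d) by rewrite Yk in Dle; lia.
rewrite Yk !expnS mulnA; apply: (@leq_trans (#|supergraphs d (Y :\ e)| * (d * d) * D ^ k)).
  by rewrite leq_mul2r (leq_trans _ H1) ?orbT // leq_mul2l DD orbT.
by rewrite [leqLHS]mulnAC [leqLHS]mulnC [leqRHS]mulnCA leq_mul2l H2 orbT.
Qed.

(** * Expansion of random regular graphs *)

Lemma sum_adj_inside n d (G : edge_set n) (A : {set 'I_n}) :
  G \in regular_graphs n d ->
  \sum_c \sum_e [&& c \in A, e \in A & adj G c e] + boundary G A = d * #|A|.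
Proof.
move=> Gr; rewrite /boundary mulnC -sum_nat_const [X in _ + X = _]big_mkcond.
rewrite [RHS]big_mkcond -big_split; apply: eq_bigr => c _ /=.
case: (c \in A) => /=; last by rewrite big1.
rewrite -(sum_adj c Gr) [X in _ + X = _]big_mkcond -big_split; apply: eq_bigr => e _ /=.
by rewrite inE; case: (e \in A); rewrite ?addn0.
Qed.

(** The removed edges lie inside [A] and inside its complement, and both new ones cross. *)
Lemma boundary_switch n d (G : edge_set n) (A : {set 'I_n}) a b c e :
  G \in regular_graphs n d -> switchable G a b c e ->
  a \in A -> b \in A -> c \notin A -> e \notin A ->
  boundary (switch G a b c e) A = (boundary G A).+2.
Proof.
move=> Gr sw aA bA cA eA.
have point x y : x \in A -> y \notin A ->
    \sum_(u in A) \sum_(v in ~: A) ((u == x) && (v == y)) = 1.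
  move=> xA yA; rewrite (bigD1 x) //= (bigD1 y) ?inE //= !eqxx /=.
  rewrite !big1 // => [v /andP [_ /negbTE ->]|u /andP [_ /negbTE ->]] //.
  by rewrite big1.
rewrite -[RHS]addn2 -[2]/(1 + 1) -{1}(point a c aA cA) -(point b e bA eA).
rewrite -!big_split; apply: eq_bigr => u uA /=.
rewrite -!big_split; apply: eq_bigr => v; rewrite inE => vA /=.
have /and5P [ab _ _ _ /andP [nac nbe]] := sw.
rewrite /adj in nac nbe; rewrite /adj !inE !set2_eq.
have [nva nvb] : v != a /\ v != b.
  by split; [apply: contraNneq vA => ->|apply: contraNneq vA => ->].
have [nuc nue] : u != c /\ u != e.
  by split; [apply: contraNneq cA => <-|apply: contraNneq eA => <-].
rewrite (negbTE nva) (negbTE nvb) (negbTE nuc) (negbTE nue) !andbF !orbF /=.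
have [/andP [/eqP ua /eqP vc]|n1] := boolP ((u == a) && (v == c)).
  rewrite ua vc (negbTE nac) add0n.
  by have /negbTE -> : a != b := adj_irr Gr ab.
have [/andP [/eqP -> /eqP ->]|_] := boolP ((u == b) && (v == e)).
  by rewrite (negbTE nbe).
by rewrite !addn0.
Qed.

Definition boundary_class n d (A : {set 'I_n}) k : {set edge_set n} :=
  [set G in regular_graphs n d | boundary G A == k].

(** Double count of the switchings of an edge inside [A] with one inside the complement, edges being
    ordered pairs. There are d|A| - k of the former and d|~A| - k of the latter, at most 2d^2 of
    which are blocked because a new edge is already present. Conversely, two of the k + 2 boundary
    edges determine the switching. *)
Lemma boundary_class_step n d (A : {set 'I_n}) k :
  #|boundary_class d A k| *
    ((d * #|A| - k) * (d * #|~: A| - k - 2 * (d * d)))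
  <= #|boundary_class d A k.+2| * (k.+2 * k.+2).
Proof.
pose P (G : edge_set n) (a b c e : 'I_n) := (G \in boundary_class d A k) &&
  ([&& a \in A, b \in A & adj G a b] &&
   [&& [&& c \in ~: A, e \in ~: A & adj G c e], ~~ adj G a c & ~~ adj G b e]).
pose Q (G : edge_set n) (a b c e : 'I_n) := (G \in boundary_class d A k.+2) &&
  ([&& a \in A, c \in ~: A & adj G a c] &&
   [&& b \in A, e \in ~: A & adj G b e]).
have PQ (G : edge_set n) a b c e : P G a b c e -> [/\ G \in regular_graphs n d,
    switchable G a b c e & Q (switch G a b c e) a b c e].
  move=> /andP [GN /andP [/and3P [aA bA ab]]].
  move=> /andP [/and3P [cA eA ce] /andP [nac nbe]].
  move: GN cA eA; rewrite [G \in _]in_set !in_setC => /andP [Gr /eqP cG] cA eA.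
  have sw : switchable G a b c e.
    apply/and5P; split=> //; last by rewrite nac.
      by apply: contraNneq cA => <-.
    by apply: contraNneq eA => <-.
  split=> //; rewrite /Q in_set (switch_regular Gr sw) (boundary_switch Gr sw) //= cG.
  by rewrite aA bA !in_setC cA eA eqxx /= /adj /switch !inE !eqxx orbT.
apply: leq_trans (leq_trans (switch_count PQ) _).
  rewrite -sum_nat_const big_mkcond; apply: leq_sum => G _; rewrite /P.
  have [GN|//] /= := boolP (G \in _).
  have /andP [Gr /eqP cG] : (G \in regular_graphs n d) && (boundary G A == k).
    by move: GN; rewrite in_set.
  have -> : d * #|A| - k = \sum_a \sum_b [&& a \in A, b \in A & adj G a b].
    by rewrite -(sum_adj_inside A Gr) cG addnK.
  rewrite big_distrl; apply: leq_sum => a _; rewrite big_distrl /=.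
  apply: leq_sum => b _; case: [&& _, _ & _]; last by rewrite mul0n.
  rewrite mul1n -subnDA leq_subLR -(sum_adj_inside (~: A) Gr) boundary_setC cG.
  rewrite addnC -[leqRHS]addnA leq_add2l.
  rewrite mul2n -addnn -{1}(sum_adj_path a Gr) -(sum_adj_path b Gr).
  rewrite [\sum_c \sum_e (adj G b c && _)]exchange_big.
  rewrite addnC -!big_split; apply: leq_sum => c _ /=.
  rewrite -!big_split; apply: leq_sum => e _ /=.
  rewrite [adj G e c]adjC.
  by case: (adj G c e) (adj G a c) (adj G b e) (c \in _) (e \in _)
    => [] [] [] [] [].
rewrite -sum_nat_const [leqRHS]big_mkcond; apply: leq_sum => G _; rewrite /Q.
have [GN|_] /= := boolP (G \in _); last first.
  by rewrite big1 // => *; rewrite big1 // => *; rewrite big1 // => *; rewrite big1.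
have cG : boundary G A = k.+2 by move: GN; rewrite in_set => /andP [_ /eqP].
have boundaryE : \sum_a \sum_c [&& a \in A, c \in ~: A & adj G a c] = k.+2.
  rewrite -cG /boundary [RHS]big_mkcond; apply: eq_bigr => a _.
  case: (a \in A); last by rewrite big1.
  by rewrite [RHS]big_mkcond; apply: eq_bigr => c _; case: (c \in ~: A).
rewrite -{1}boundaryE big_distrl; apply: leq_sum => a _ /=.
rewrite exchange_big big_distrl; apply: leq_sum => c _ /=.
rewrite -boundaryE big_distrr; apply: leq_sum => b _ /=.
rewrite big_distrr; apply: leq_sum => e _ /=.
by rewrite mulnb.
Qed.

(** Iterates the preceding step [k] times. Halving the counts of ordered pairs cancels a factor 4
    and leaves falling factorials; division by k!^2 gives binomials. *)
Lemma boundary_class_growth n d (A : {set 'I_n}) b k x y :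
  x = (d * #|A| - b)./2 -> y = (d * #|~: A| - b)./2 - d * d ->
  #|boundary_class d A b| * ('C(x, k) * 'C(y, k))
  <= #|boundary_class d A (b + k.*2)| * 'C(uphalf b + k, k) ^ 2.
Proof.
move=> xE yE; set h := uphalf b.
have step j : #|boundary_class d A (b + j.*2)| * ((x - j) * (y - j))
    <= #|boundary_class d A (b + j.+1.*2)| * ((h + j).+1 * (h + j).+1).
  have := boundary_class_step d A (b + j.*2).
  have -> : (b + j.*2).+2 = b + j.+1.*2 by rewrite doubleS !addnS.
  set c := #|_|; set c' := #|boundary_class d A (b + j.+1.*2)| => H.
  have h1 : 2 * (x - j) <= d * #|A| - (b + j.*2).
    by rewrite xE; move: (d * _) => e; clear; lia.
  have h2 : 2 * (y - j) <= d * #|~: A| - (b + j.*2) - 2 * (d * d).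
    by rewrite yE; move: (d * #|_|) (d * d) => e f; clear; lia.
  have h3 : (b + j.+1.*2) <= 2 * (h + j).+1 by rewrite /h; clear; lia.
  rewrite -(leq_pmul2l (isT : 0 < 4)) -[4]/(2 * 2).
  apply: (@leq_trans (c * ((2 * (x - j)) * (2 * (y - j))))).
    by rewrite mulnACA; apply/eq_leq; ring.
  apply: leq_trans (leq_trans (leq_mul (leqnn c) (leq_mul h1 h2)) H) _.
  apply: leq_trans (leq_mul (leqnn c') (leq_mul h3 h3)) _.
  by apply/eq_leq; ring.
have grow : #|boundary_class d A b| * (x ^_ k * y ^_ k)
    <= #|boundary_class d A (b + k.*2)| * ((h + k) ^_ k * (h + k) ^_ k).
  elim: k => [|k IH]; first by rewrite double0 !addn0 !ffactn0.
  rewrite [x ^_ _]ffactnSr [y ^_ _]ffactnSr addnS [(h + k).+1 ^_ k.+1]ffactnS /=.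
  set c := #|boundary_class d A b| in IH *.
  set c' := #|boundary_class d A (b + k.*2)| in IH *; set c'' := #|_|.
  apply: (@leq_trans (c' * ((h + k) ^_ k * (h + k) ^_ k) * ((x - k) * (y - k)))).
    by rewrite mulnACA mulnA leq_mul2r IH orbT.
  rewrite mulnAC; apply: leq_trans (leq_mul (step k) (leqnn _)) _.
  by rewrite -/c''; apply/eq_leq; ring.
have k2 : 0 < k`! * k`! by rewrite muln_gt0 fact_gt0.
rewrite -(leq_pmul2r k2) -[leqLHS]mulnA mulnACA !bin_ffact.
by rewrite -mulnn -[leqRHS]mulnA mulnACA !bin_ffact.
Qed.

(** Sums the preceding bound over k = 0, ..., x: Vandermonde's identity evaluates the left side, and
    on the right the classes with boundary b + 2k are disjoint. *)
Lemma boundary_class_le n d (A : {set 'I_n}) b x y :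
  x = (d * #|A| - b)./2 -> y = (d * #|~: A| - b)./2 - d * d ->
  #|boundary_class d A b| * 'C(x + y, x)
  <= #|regular_graphs n d| * 'C(uphalf b + x, x) ^ 2.
Proof.
move=> xE yE; rewrite addnC -binomial.Vandermonde big_distrr /=.
apply: (@leq_trans (\sum_(i < x.+1)
    #|boundary_class d A (b + i.*2)| * 'C(uphalf b + x, x) ^ 2)).
  apply: leq_sum => i _; have ix : i <= x by rewrite -ltnS.
  rewrite bin_sub // [_ * 'C(x, i)]mulnC.
  apply: leq_trans (boundary_class_growth _ xE yE) _.
  rewrite leq_mul2l leq_exp2r // -(bin_sub (leq_addl _ i)) addnK.
  by rewrite -(bin_sub (leq_addl _ x)) addnK leq_bin2l ?orbT // leq_add2l.
rewrite -big_distrl leq_mul2r /=; apply/orP; right.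
rewrite -[leqLHS]big_enum /=.
have -> : \sum_(i <- enum 'I_x.+1) #|boundary_class d A (b + i.*2)|
    = \sum_(G in regular_graphs n d) \sum_(i < x.+1) (boundary G A == b + i.*2).
  rewrite exchange_big big_enum; apply: eq_bigr => i _ /=.
  by rewrite -sum1dep_card big_mkcondr.
rewrite -sum1_card; apply: leq_sum => G _.
have [/existsP [i /eqP Gi]|] := boolP [exists i : 'I_x.+1, boundary G A == b + i.*2].
  rewrite (bigD1 i) //= Gi eqxx big1 // => j; rewrite eqn_add2l => ji.
  by case: eqP => // /double_inj/val_inj E; rewrite E eqxx in ji.
by move/existsPn => H; rewrite big1 // => i _; rewrite (negbTE (H i)).
Qed.

(** * Binomial estimates and the union bound over non-expanding sets *)

Lemma leq_bin_add x y u v : x <= u -> y <= v -> 'C(x + y, x) <= 'C(u + v, u).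
Proof.
move=> xu yv; apply: (@leq_trans 'C(x + v, x)).
  by rewrite leq_bin2l // leq_add2l.
rewrite -(bin_sub (leq_addr _ x)) addKn -(bin_sub (leq_addr _ u)) addKn.
by rewrite leq_bin2l // leq_add2r.
Qed.

Lemma leq_bin_mul m n a b : 'C(m, a) * 'C(n, b) <= 'C(m + n, a + b).
Proof.
rewrite -binomial.Vandermonde (bigD1 (inord a)) //= inordK; last by rewrite ltnS leq_addr.
by rewrite addKn leq_addr.
Qed.

(** Raising a to a + 1 multiplies the binomial by (a+1+m)/(a+1) >= 2. The factor m + 1, from a = 1,
    becomes the 1/n in the probability of not being an expander. *)
Lemma bin_exp_lb a m : 0 < a -> a <= m -> m.+1 * 2 ^ a.-1 <= 'C(a + m, a).
Proof.
case: a => // a _; elim: a => [|a IH] am; first by rewrite bin1 muln1 add1n.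
rewrite -(leq_pmul2l (ltn0Sn a.+1)) -mul_bin_diag /= expnS.
by have := IH (ltnW am); rewrite /= addSn /=; move: 'C(_, _) (2 ^ _) => u v; nia.
Qed.

(** A vertex of [A] has at most |A| - 1 < d neighbours in [A], hence at least one outside. *)
Lemma small_set_expands n d (G : edge_set n) (A : {set 'I_n}) :
  G \in regular_graphs n d -> #|A| <= d -> #|A| <= boundary G A.
Proof.
move=> Gr Ad; rewrite -sum1_card; apply: leq_sum => u uA.
have : \sum_(v in A) adj G u v <= #|A| - 1.
  have -> : #|A| - 1 = \sum_(v in A) (v != u).
    rewrite (bigD1 u) //= eqxx add0n (cardsD1 u) uA addKn -sum1_card.
    rewrite [RHS]big_mkcond [LHS]big_mkcond; apply: eq_bigr => v _.
    by rewrite !inE andbC; case: (v \in A); case: (v != u).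
  apply: leq_sum => v _; case: (boolP (adj G u v)) => // /(adj_irr Gr).
  by rewrite eq_sym => ->.
have := sum_adj u Gr; rewrite (bigID (mem A)) /=.
rewrite [X in _ + X](eq_bigl (fun v => v \in ~: A)); last by move=> v; rewrite inE.
have : 0 < #|A| by apply/card_gt0P; exists u.
set p := \sum_(v in A) _; set r := \sum_(v in ~: A) _; move: Ad.
by move: #|A| p r; clear; lia.
Qed.

(** As d >= 3, the parameters x and y of the preceding estimate exceed |A| and n - |A| by a quarter.
    The main parts give 'C(n, |A|), which pays for the choice of [A]; the surplus quarters give
    exponential decay. *)
Lemma boundary_class_bound n d (A : {set 'I_n}) b :
  3 <= d -> 16 * (d * d) + 8 <= n -> 4 <= #|A| -> 2 * #|A| <= n ->
  4 * b < #|A| ->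
  #|boundary_class d A b| * ('C(n, #|A|) * ((n - #|A|) %/ 4).+1 * 2 ^ (#|A| %/ 4).-1)
  <= #|regular_graphs n d| * 'C(uphalf b + (d * #|A|)./2, uphalf b) ^ 2.
Proof.
move=> d3 nd a4 an ba; have cA : #|~: A| = n - #|A|.
  by rewrite cardsCs setCK card_ord.
have [x xE] : exists x, x = (d * #|A| - b)./2 by eexists.
have [y yE] : exists y, y = (d * #|~: A| - b)./2 - d * d by eexists.
have H := boundary_class_le xE yE; rewrite cA in yE.
move: H xE yE ba an a4; set N := #|boundary_class _ _ _|.
set a := #|A|; clearbody N a; clear A cA => H xE yE ba an a4.
have da : 3 * a <= d * a by rewrite leq_mul2r d3 orbT.
have dna : 3 * (n - a) <= d * (n - a) by rewrite leq_mul2r d3 orbT.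
have xa : a + a %/ 4 <= x by rewrite xE; lia.
have ya : (n - a) + (n - a) %/ 4 <= y by rewrite yE; lia.
apply: leq_trans (leq_trans H _).
  rewrite leq_mul2l; apply/orP; right.
  apply: leq_trans (leq_bin_add xa ya); rewrite -mulnA.
  apply: (@leq_trans ('C(n, a) * 'C(a %/ 4 + (n - a) %/ 4, a %/ 4))).
    by rewrite leq_mul2l bin_exp_lb ?orbT //; lia.
  apply: leq_trans (leq_bin_mul _ _ _ _) _; apply/eq_leq; congr 'C(_, _); lia.
rewrite leq_mul2l leq_exp2r // -(bin_sub (leq_addl _ x)) addnK.
by rewrite leq_bin2l ?orbT // leq_add2l xE half_leq // leq_subr.
Qed.

Local Open Scope ring_scope.

(** The binomial times s^x is one term in the expansion of (1 + s)^(h + x). *)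
Lemma bin_exp_ub (R : realType) h x s : (0 < s)%N ->
  'C(h + x, h)%:R <= expR (x%:R / s%:R) * expR (h%:R * ln s.+1%:R) :> R.
Proof.
move=> s0; have sR : 0 < s%:R :> R by rewrite ltr0n.
have H : ('C(h + x, h) * s ^ x <= s.+1 ^ (h + x))%N.
  rewrite -addn1 expnDn (bigD1 (inord h)) //= inordK ?ltnS ?leq_addr //.
  by rewrite addKn exp1n muln1 leq_addr.
have {}H : 'C(h + x, h)%:R * s%:R ^+ x <= s.+1%:R ^+ (h + x) :> R.
  by rewrite -!natrX -natrM ler_nat.
have E1 : expR (h%:R * ln s.+1%:R) = s.+1%:R ^+ h :> R.
  by rewrite expRM_natl lnK // posrE ltr0n.
have E2 : (s.+1%:R / s%:R) ^+ x <= expR (x%:R / s%:R) :> R.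
  rewrite expRM_natl; apply: lerXn2r; rewrite ?nnegrE ?expR_ge0 ?divr_ge0 //.
  apply: le_trans (expR_ge1Dx _).
  by rewrite -addn1 natrD mulrDl divff ?gt_eqF // mul1r.
rewrite E1; apply: le_trans (ler_wpM2r _ E2); last by rewrite exprn_ge0.
rewrite expr_div_n mulrAC -exprD addnC ler_pdivlMr ?exprn_gt0 //.
by rewrite addnC.
Qed.

Lemma quarter_pred_bound a : (a <= 4 * (a %/ 4).-1 + 7)%N.
Proof. lia. Qed.

Lemma quarter_bound a n : (2 * a <= n -> n <= 8 * ((n - a) %/ 4).+1)%N.
Proof. lia. Qed.

(** With s = 80d and q at least 160 ln(s+1), both exponents in the upper bound are at most a/160, so
    the square is at most exp(a/40). On the other side 2 >= exp(1/2) gives exp(1 - a/10 + a/8 -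
    7/8), which is larger. *)
Lemma bin_decay (R : realType) d : (0 < d)%N -> exists2 q : nat, (4 <= q)%N &
  forall a b : nat, (q * b < a)%N ->
  ('C(uphalf b + (d * a)./2, uphalf b) ^ 2)%:R
  <= expR 1 * expR (- (a%:R / 10)) * (2 ^ (a %/ 4).-1)%:R :> R.
Proof.
move=> d0; pose s := (80 * d)%N; pose l : R := ln s.+1%:R.
have l0 : 0 <= l by rewrite ln_ge0 // ler1n.
exists (4 + Num.truncn (160 * l)).+1 => [|a b qba]; first lia.
have lq : 160 * l <= (4 + Num.truncn (160 * l)).+1%:R.
  by apply: ltW (lt_le_trans (truncnS_gt _) _); rewrite ler_nat ltnS leq_addl.
set q := (4 + _).+1 in qba lq.
have sd : (0 < s)%N by rewrite /s; lia.
have sE : s%:R = 80 * d%:R :> R by rewrite /s natrM.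
have dR : 0 < d%:R :> R by rewrite ltr0n.
have H := bin_exp_ub R (uphalf b) (d * a)./2 sd.
have h1 : (d * a)./2%:R / s%:R <= a%:R / 160 :> R.
  have : 2 * (d * a)./2%:R <= d%:R * a%:R :> R.
    by rewrite -!natrM ler_nat; lia.
  rewrite ler_pdivrMr ?ltr0n // sE => h.
  have -> : a%:R / 160 * (80 * d%:R) = d%:R * a%:R / 2 :> R by field.
  by rewrite ler_pdivlMr // mulrC.
have h2 : (uphalf b)%:R * l <= a%:R / 160.
  have : (q * uphalf b <= a)%N by case: b qba {H} => [|b]; nia.
  rewrite -(ler_nat R) natrM => qh; rewrite ler_pdivlMr //.
  apply: le_trans qh; rewrite -mulrA [l * _]mulrC [leRHS]mulrC.
  by apply: ler_wpM2l.
have {}H : 'C(uphalf b + (d * a)./2, uphalf b)%:R <= expR (a%:R / 80) :> R.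
  apply: le_trans H _; rewrite -expRD ler_expR; rewrite -/l; lra.
have two : expR (1 / 2) <= 2 :> R.
  have := expR_ge1Dx (- (1 / 2) : R); rewrite expRN => e.
  have e0 := expR_gt0 (1 / 2 : R).
  have : (1 / 2) * expR (1 / 2) <= (expR (1 / 2))^-1 * expR (1 / 2) :> R.
    by apply: ler_wpM2r; lra.
  by rewrite mulVf ?gt_eqF //; lra.
have pow2 : expR (a%:R / 8 - 7 / 8) <= (2 ^ (a %/ 4).-1)%:R :> R.
  apply: (@le_trans _ _ (expR ((a %/ 4).-1%:R * (1 / 2)))).
    rewrite ler_expR.
    by have := quarter_pred_bound a; rewrite -(ler_nat R) natrD natrM; lra.
  by rewrite expRM_natl natrX; apply: lerXn2r; rewrite ?nnegrE ?expR_ge0.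
apply: (@le_trans _ _ (expR (a%:R / 80) * expR (a%:R / 80))).
  by rewrite natrX expr2; apply: ler_pM.
apply: (@le_trans _ _ (expR 1 * expR (- (a%:R / 10)) * expR (a%:R / 8 - 7 / 8))).
  by rewrite -!expRD ler_expR; lra.
by apply: ler_wpM2l pow2; rewrite mulr_ge0 ?expR_ge0.
Qed.

(** Sets of at most 3 <= d vertices always expand, so the union bound may start at size 4, where
    |A|/4 is at least 1. *)
Lemma nonexpander_le n d q : (3 <= d)%N -> (0 < q)%N ->
  (#|[set G in regular_graphs n d | ~~ `[< expander q G >]]|
  <= \sum_(A : {set 'I_n} | (4 <= #|A|) && (2 * #|A| <= n))
     \sum_(b < #|A| | q * b < #|A|) #|boundary_class d A b|)%N.
Proof.
move=> d3 q0.
have -> : (\sum_(A : {set 'I_n} | (4 <= #|A|) && (2 * #|A| <= n))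
     \sum_(b < #|A| | q * b < #|A|) #|boundary_class d A b| = \sum_G
   \sum_(A : {set 'I_n} | (4 <= #|A|) && (2 * #|A| <= n))
     \sum_(b < #|A| | q * b < #|A|) (G \in boundary_class d A b))%N.
  rewrite [RHS]exchange_big; apply: eq_bigr => A _ /=.
  rewrite [RHS]exchange_big; apply: eq_bigr => b _ /=.
  by rewrite -sum1_card [LHS]big_mkcond; apply: eq_bigr => G _; case: (_ \in _).
rewrite -sum1_card big_mkcond; apply: leq_sum => G _.
case: (boolP (G \in _)) => //; rewrite in_set => /andP [Gr /asboolPn].
rewrite /expander => /existsNP [A] /not_implyP [An] /negP; rewrite -ltnNge => Ac.
have A4 : (4 <= #|A|)%N.
  rewrite leqNgt; apply/negP => A4.
  have Ad : (#|A| <= d)%N by apply: leq_trans d3; rewrite -ltnS.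
  by have := small_set_expands Gr Ad; nia.
rewrite (bigD1 A) /= ?A4 //.
have cA : (boundary G A < #|A|)%N by nia.
rewrite (bigD1 (Ordinal cA)) //= in_set Gr eqxx.
by rewrite -addnA leq_addr.
Qed.

Lemma sum_by_card (R : realType) n (F : nat -> R) :
  \sum_(A : {set 'I_n}) F #|A| = \sum_(a < n.+1) 'C(n, a)%:R * F a.
Proof.
have cAn (A : {set 'I_n}) : (#|A| < n.+1)%N.
  by rewrite ltnS -[leqRHS]card_ord max_card.
rewrite (partition_big (fun A => Ordinal (cAn A)) predT) //=.
apply: eq_bigr => a _.
rewrite (eq_bigr (fun _ => F a)); last by move=> A /eqP <-.
rewrite sumr_const -[_ *+ _]mulr_natl; congr (_%:R * _).
have := card_draws 'I_n a; rewrite card_ord => <-.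
by apply: eq_card => A; rewrite inE.
Qed.

Lemma geometric_le (R : realType) (r : R) n : 0 <= r -> r < 1 ->
  \sum_(a < n) r ^+ a <= (1 - r)^-1.
Proof.
move=> r0 r1; have r1' : 0 < 1 - r by lra.
rewrite -[leRHS]mul1r ler_pdivlMr // mulrC.
have := subrX1 r n; have : 0 <= r ^+ n by rewrite exprn_ge0.
lra.
Qed.

(** The number of sets of size a cancels the factor 'C(n, a) of the class bound, and a geometric
    series in a remains, multiplied by a constant over n. *)
Lemma nonexpanders_rare (R : realType) d : (3 <= d)%N ->
  exists (q : nat) (B : R), [/\ (0 < q)%N, 0 < B &
  forall n, (16 * (d * d) + 8 <= n)%N ->
  #|[set G in regular_graphs n d | ~~ `[< expander q G >]]|%:R
  <= B / n%:R * #|regular_graphs n d|%:R].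
Proof.
move=> d3; have [|q q4 decay] := bin_decay R (d := d); first lia.
pose r : R := expR (- (1 / 20)).
have r0 : 0 < r := expR_gt0 _.
have r1 : r < 1 by rewrite expR_lt1; lra.
pose K : R := 20 * expR 1.
have K0 : 0 < K by rewrite mulr_gt0 ?expR_gt0.
exists q, (8 * K * (1 - r)^-1); split; first lia.
  by rewrite !mulr_gt0 ?invr_gt0 ?subr_gt0 ?expR_gt0 //.
move=> n nd; set N := #|regular_graphs n d|.
have n0 : 0 < n%:R :> R by rewrite ltr0n; lia.
have q0 : (0 < q)%N by lia.
apply: (@le_trans _ _ (\sum_(A : {set 'I_n})
    (8 / n%:R * N%:R * K) * (r ^+ #|A| / 'C(n, #|A|)%:R))).
  have := nonexpander_le n d3 q0; rewrite -(ler_nat R) => /le_trans; apply.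
  rewrite natr_sum big_mkcond; apply: ler_sum => A _.
  have C0 : 0 < 'C(n, #|A|)%:R :> R.
    by rewrite ltr0n bin_gt0 -[leqRHS]card_ord max_card.
  have rhs0 : 0 <= 8 / n%:R * N%:R * K * (r ^+ #|A| / 'C(n, #|A|)%:R).
    by rewrite !mulr_ge0 ?invr_ge0 ?exprn_ge0 ?ler0n ?expR_ge0.
  case: ifP => // /andP [A4 An].
  set a := #|A| in A4 An C0 rhs0 *.
  rewrite natr_sum.
  apply: (@le_trans _ _ (\sum_(b < a) 8 / n%:R * N%:R *
     (expR 1 * expR (- (a%:R / 10))) / 'C(n, a)%:R)).
    rewrite big_mkcond; apply: ler_sum => b _.
    case: ifP => [qb|_]; last first.
      by rewrite !mulr_ge0 ?invr_ge0 ?expR_ge0 ?ler0n.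
    have b4 : (4 * b < a)%N by apply: leq_ltn_trans qb; rewrite leq_mul2r q4 orbT.
    have H := @boundary_class_bound n d A b d3 nd A4 An b4.
    have P0 : 0 < (2 ^ (a %/ 4).-1)%:R :> R by rewrite ltr0n expn_gt0.
    have m0 : 0 < ((n - a) %/ 4).+1%:R :> R by rewrite ltr0n.
    have nm : n%:R <= 8 * ((n - a) %/ 4).+1%:R :> R.
      by rewrite -natrM ler_nat; apply: quarter_bound.
    move: H; rewrite -/a -/N -(ler_nat R) !natrM => H.
    have := decay _ _ qb; rewrite -mulnn natrM => Cb.
    have {}H := le_trans H (ler_wpM2l (ler0n R N) Cb).
    rewrite [leLHS]mulrA [leRHS]mulrA ler_pM2r // mulrA -ler_pdivlMr // in H.
    rewrite ler_pdivlMr //; apply: le_trans H _.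
    rewrite [leLHS]mulrC -[leRHS]mulrA; apply: ler_wpM2r.
      by rewrite !mulr_ge0 ?expR_ge0.
    by rewrite ler_pdivlMr // mulrC ler_pdivrMr.
  rewrite sumr_const card_ord -[_ *+ a]mulr_natl.
  (* Half of the exponential pays for the at most [a] values of b, since x exp(-x) <= 1 for x =
     a/20. *)
  have ar : a%:R * (expR 1 * expR (- (a%:R / 10))) <= K * r ^+ a.
    have -> : r ^+ a = expR (- (a%:R / 20)).
      by rewrite /r -expRM_natl; congr expR; lra.
    have -> : - (a%:R / 10) = - (a%:R / 20) + - (a%:R / 20) :> R by lra.
    rewrite expRD /K; set e := expR (- _); set f := expR 1.
    have e0 : 0 < e := expR_gt0 _.
    have : a%:R / 20 * e <= 1.
      rewrite -[leRHS](expRxMexpNx_1 (a%:R / 20)) ler_pM2r //.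
      by apply: le_trans (expR_ge1Dx _); lra.
    move=> ae; have f0 : 0 < f := expR_gt0 _.
    have -> : a%:R * (f * (e * e)) = 20 * f * e * (a%:R / 20 * e) by field.
    by rewrite ler_piMr // !mulr_ge0 // ltW.
  set c := ('C(n, a)%:R)^-1; set g := 8 / n%:R * N%:R.
  have gc : 0 <= g * c by rewrite mulr_ge0 ?invr_ge0 ?(ltW C0) // mulr_ge0 ?divr_ge0.
  have -> : a%:R * (g * (expR 1 * expR (- (a%:R / 10))) * c) =
    g * c * (a%:R * (expR 1 * expR (- (a%:R / 10)))) by ring.
  have -> : g * K * (r ^+ a * c) = g * c * (K * r ^+ a) by ring.
  by apply: ler_wpM2l.
rewrite (sum_by_card n (fun a => 8 / n%:R * N%:R * K * (r ^+ a / 'C(n, a)%:R))).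
rewrite (eq_bigr (fun a : 'I_n.+1 => 8 / n%:R * N%:R * K * r ^+ a)); last first.
  move=> a _; have C0 : 'C(n, a)%:R != 0 :> R.
    by rewrite pnatr_eq0 -lt0n bin_gt0 -ltnS.
  by rewrite mulrCA [X in _ * X]mulrCA divff // mulr1.
rewrite -big_distrr /=.
apply: le_trans (ler_wpM2l _ (geometric_le n.+1 (ltW r0) r1)) _.
  by rewrite !mulr_ge0 ?invr_ge0 ?ler0n ?expR_ge0.
by rewrite le_eqVlt; apply/orP; left; apply/eqP; ring.
Qed.

(** * Union bound *)

Definition fixed_set n (pi : {ffun 'I_n -> 'I_n}) : {set 'I_n} :=
  [set v | pi v == v].

(** The fixed point that the iterates of [pi] reach from [v]; the default [v] is returned when they
    reach none. *)
Definition root_of n (pi : {ffun 'I_n -> 'I_n}) (v : 'I_n) : 'I_n :=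
  odflt v [pick s | (pi s == s) && fconnect pi v s].

Definition parent_edges n (pi : {ffun 'I_n -> 'I_n}) : edge_set n :=
  [set [set v; pi v] | v in ~: fixed_set pi].

Definition pairs_of n (r : rel 'I_n) : edge_set n :=
  [set e | [exists u, exists v, [&& u != v, e == [set u; v] & r u v]]].

(* A graph is compressible if it contains a forest of parent pointers pi with
   few roots such that, once the roots are labelled by phi and every vertex
   inherits the label of its root, many of the other edges of the graph join
   vertices with near labels although few pairs of vertices have near labels.
   Fixing phi to be i0 off the roots leaves #|I| ^ #|fixed_set pi| choices. *)
Definition code_of n (I K : finType) (i0 : I) (near : K -> rel I) (m s : nat)
    (G : edge_set n) (pi : {ffun 'I_n -> 'I_n}) (phi : {ffun 'I_n -> I})
    (k : K) : bool :=
  let near_pairs :=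
    pairs_of (fun u v => near k (phi (root_of pi u)) (phi (root_of pi v))) in
  [&& (#|fixed_set pi| * m <= n)%N,
      phi \in pffun_on i0 (mem (fixed_set pi)) predT,
      #|parent_edges pi| == (n - #|fixed_set pi|)%N,
      parent_edges pi \subset G, (s * #|near_pairs| <= n * n)%N
    & (n %/ 4 <= #|(G :&: near_pairs) :\: parent_edges pi|)%N].

Definition compressible n (I K : finType) (i0 : I) (near : K -> rel I)
    (m s : nat) (G : edge_set n) : bool :=
  [exists pi, exists phi, exists k, code_of i0 near m s G pi phi k].

(** Here D = n/4 works: 2|Y| <= 5n/2 and dn >= 3n leave another n/4 for the terms in d. Rounding n/4
    down turns 4d^2/n into 8d^2/n. *)
Lemma card_supergraphs_real (R : realType) n d (Y : edge_set n) :
  (3 <= d)%N -> (8 + 16 * (d * d) <= n)%N ->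
  (forall e, e \in Y -> #|e| = 2%N) -> (#|Y| <= n + n %/ 4)%N ->
  #|supergraphs d Y|%:R
  <= #|regular_graphs n d|%:R * ((8 * (d * d))%:R / n%:R) ^+ #|Y| :> R.
Proof.
move=> d3 nd Y2 Yn.
have dn : (n %/ 4 + 2 * #|Y| + 2 * (d + d * d) <= d * n)%N.
  have : (3 * n <= d * n)%N by rewrite leq_mul2r d3 orbT.
  have : (d <= d * d)%N by rewrite leq_pmulr //; apply: leq_trans d3.
  by move: Yn nd; clear; lia.
have := card_supergraphs dn Y2; rewrite -(ler_nat R) !natrM !natrX => H.
have D0 : 0 < (n %/ 4)%:R :> R by rewrite ltr0n; move: nd; clear; lia.
have n0 : 0 < n%:R :> R by rewrite ltr0n; move: nd; clear; lia.
rewrite -ler_pdivlMr ?exprn_gt0 // -mulrA -expr_div_n in H.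
apply: le_trans H _; apply: ler_wpM2l => //; apply: lerXn2r.
- by rewrite nnegrE divr_ge0.
- by rewrite nnegrE divr_ge0 ?mulr_ge0 ?ler0n.
rewrite !natrM ler_pdivrMr // mulrAC ler_pdivlMr //.
have : n%:R <= 8 * (n %/ 4)%:R :> R.
  by rewrite -natrM ler_nat; move: nd; clear; lia.
move=> n8; rewrite [8 * _ * _]mulrAC [leRHS]mulrC.
by apply: ler_wpM2l n8; rewrite mulr_ge0 ?ler0n.
Qed.

(** The sum factors over the vertices: each contributes 1 for being fixed and at most n times c/n
    for its other images. *)
Lemma sum_parent_maps (R : realType) n (c : R) : 0 <= c -> (0 < n)%N ->
  \sum_(pi : {ffun 'I_n -> 'I_n}) (c / n%:R) ^+ (n - #|fixed_set pi|)
  <= (1 + c) ^+ n.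
Proof.
move=> c0 n0; have nR : 0 < n%:R :> R by rewrite ltr0n.
pose F (v u : 'I_n) : R := if u == v then 1 else c / n%:R.
have E (pi : {ffun 'I_n -> 'I_n}) :
    (c / n%:R) ^+ (n - #|fixed_set pi|) = \prod_v F v (pi v).
  rewrite (bigID (fun v => pi v == v)) /= big1 ?mul1r => [|v pv]; last first.
    by rewrite /F pv.
  rewrite (eq_bigr (fun=> c / n%:R)); last by move=> v; rewrite /F => /negbTE ->.
  rewrite prodr_const; congr (_ ^+ _).
  have cC := cardsC (fixed_set pi); rewrite card_ord in cC.
  rewrite -[X in (X - _)%N = _]cC addKn.
  by apply: eq_card => v; rewrite !inE.
under eq_bigr => pi _ do rewrite E.
rewrite -bigA_distr_bigA /= -[n in leRHS]card_ord -prodr_const.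
apply: ler_prod => v _; apply/andP; split.
  by apply: sumr_ge0 => u _; rewrite /F; case: ifP => // _; rewrite divr_ge0.
rewrite (bigD1 v) //= {1}/F eqxx lerD2l.
rewrite (eq_bigr (fun=> c / n%:R)); last by move=> u; rewrite /F => /negbTE ->.
rewrite sumr_const -[leLHS]mulr_natl mulrA ler_pdivrMr // mulrC.
by apply: ler_wpM2l => //; rewrite ler_nat -[leqRHS]card_ord max_card.
Qed.

(** The binomial is at most T^j/j!, and j^j/j! <= e^j as a term of the exponential series. *)
Lemma bin_entropy (R : realType) (T j : nat) : (0 < j)%N ->
  'C(T, j)%:R <= (expR 1 * T%:R / j%:R) ^+ j :> R.
Proof.
move=> j0; have jR : 0 < j%:R :> R by rewrite ltr0n.
have fR : 0 < j`!%:R :> R by rewrite ltr0n fact_gt0.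
have CT : 'C(T, j)%:R * j`!%:R <= T%:R ^+ j :> R.
  rewrite -natrM bin_ffact -natrX ler_nat; elim: (j) => [|i IH].
    by rewrite ffactn0.
  by rewrite ffactnSr expnSr leq_mul // leq_subr.
have ej : j%:R ^+ j <= j`!%:R * expR 1 ^+ j :> R.
  rewrite -expRM_natl mulr1 mulrC -ler_pdivrMr //.
  have := @expR_ge1Dxn R j%:R j.-1 (ler0n _ _); rewrite prednK //; lra.
rewrite !expr_div_n exprMn ler_pdivlMr ?exprn_gt0 //.
apply: le_trans (ler_wpM2l (ler0n _ _) ej) _.
by rewrite mulrA mulrC; apply: ler_wpM2l; rewrite ?exprn_ge0 ?expR_ge0.
Qed.

Lemma card_in_pairs_of n (r : rel 'I_n) e : e \in pairs_of r -> #|e| = 2%N.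
Proof.
rewrite inE => /existsP [u /existsP [v /and3P [uv /eqP -> _]]].
by rewrite cards2 uv.
Qed.

Lemma card_in_parent_edges n (pi : {ffun 'I_n -> 'I_n}) e :
  e \in parent_edges pi -> #|e| = 2%N.
Proof.
by case/imsetP => v; rewrite !inE => pv ->; rewrite cards2 eq_sym pv.
Qed.

Lemma exists_subset_card (T : finType) (A : {set T}) k : (k <= #|A|)%N ->
  exists2 B : {set T}, B \subset A & #|B| = k.
Proof.
case/card_geqP => s [us <- sA]; exists [set x in s].
  by apply/subsetP => x; rewrite inE => /sA.
by rewrite cardsE; apply/card_uniqP.
Qed.

Lemma compressible_le n d (I K : finType) (i0 : I) (near : K -> rel I) m s :
  (#|[set G in regular_graphs n d | compressible i0 near m s G]| <=
  \sum_(pi : {ffun 'I_n -> 'I_n} | (#|fixed_set pi| * m <= n) &&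
                      (#|parent_edges pi| == n - #|fixed_set pi|))
  \sum_(phi in pffun_on i0 (mem (fixed_set pi)) (@predT I))
  \sum_(k : K | s * #|pairs_of (fun u v =>
                  near k (phi (root_of pi u)) (phi (root_of pi v)))| <= n * n)
  \sum_(X : edge_set n | (X \subset pairs_of (fun u v =>
      near k (phi (root_of pi u)) (phi (root_of pi v))) :\: parent_edges pi) &&
      (#|X| == n %/ 4))
    #|supergraphs d (parent_edges pi :|: X)|)%N.
Proof.
have sum_card (X : edge_set n) :
    #|supergraphs d X| = (\sum_G (G \in supergraphs d X))%N.
  by rewrite -sum1_card big_mkcond; apply: eq_bigr => G _; case: (_ \in _).
under eq_bigr => pi _ do under eq_bigr => phi _ do under eq_bigr => k _ do
  under eq_bigr => X _ do rewrite sum_card.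
under eq_bigr => pi _ do under eq_bigr => phi _ do under eq_bigr => k _ do
  rewrite exchange_big.
under eq_bigr => pi _ do under eq_bigr => phi _ do rewrite exchange_big.
under eq_bigr => pi _ do rewrite exchange_big.
rewrite exchange_big -sum1_card big_mkcond; apply: leq_sum => G _ /=.
case: (boolP (G \in _)) => //; rewrite in_set => /andP [Gr].
case/existsP => pi /existsP [phi /existsP [k]].
case/and5P => piS phiS pe peG /andP [NP].
case/exists_subset_card => X XS Xj.
rewrite (bigD1 pi) ?piS //= (bigD1 phi) //= (bigD1 k) //= (bigD1 X) /=; last first.
  by rewrite Xj eqxx andbT; apply: subset_trans XS _; rewrite setSD // subsetIr.
rewrite in_set Gr /= subUset peG (subset_trans XS) //.
by rewrite (subset_trans (subsetDl _ _)) ?subsetIl.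
Qed.

(** The union bound has these factors: (1+C)^n for the forests with the probability of their edges,
    2^n for the labels of at most n/m roots, 2^n for the thresholds, and [delta] for the n/4 further
    edges. As [delta] is at most A^-n with A = 8(1+C), the product is at most 2^-n. *)
Lemma compressible_rare (R : realType) d : (3 <= d)%N ->
  exists2 s : nat, (0 < s)%N &
  forall n (I K : finType) (i0 : I) (near : K -> rel I) m,
  (8 + 16 * (d * d) <= n)%N -> (2 * m <= n)%N -> (#|I| <= 2 ^ m)%N ->
  (#|K| <= #|I| ^ 2)%N ->
  #|[set G in regular_graphs n d | compressible i0 near m s G]|%:R
  <= n%:R^-1 * #|regular_graphs n d|%:R :> R.
Proof.
move=> d3; pose C : R := (8 * (d * d))%:R; pose A : R := 8 * (1 + C).
have C0 : 0 <= C by rewrite ler0n.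
have A8 : 8 <= A by rewrite /A; lra.
(* This makes 8eC/s at most A^-8; the power 8 suits j = n/4 rounded down, for which 8j >= n. *)
pose s := (Num.truncn (8 * expR 1 * C * A ^+ 8)).+1.
have sR : 8 * expR 1 * C * A ^+ 8 <= s%:R by apply/ltW/truncnS_gt.
exists s => // n I K i0 near m nd mn IN KN.
set N := #|regular_graphs n d|; set j := (n %/ 4)%N.
have n0 : 0 < n%:R :> R by rewrite ltr0n; move: nd; clear; lia.
have n0' : (0 < n)%N by move: nd; clear; lia.
have j0 : (0 < j)%N by rewrite /j; move: nd; clear; lia.
have j0R : 0 < j%:R :> R by rewrite ltr0n.
have s0 : 0 < s%:R :> R by rewrite ltr0n.
have nj : n%:R <= 8 * j%:R :> R.
  by rewrite -natrM ler_nat /j; move: nd; clear; lia.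
pose delta : R := (8 * expR 1 * C / s%:R) ^+ j.
have delta0 : 0 <= delta.
  by rewrite exprn_ge0 // divr_ge0 // !mulr_ge0 ?expR_ge0 ?ler0n.
have q0 : 0 <= C / n%:R by rewrite divr_ge0 // ltW.
have XB (pi : {ffun 'I_n -> 'I_n}) (NP : edge_set n) :
    (forall e, e \in NP -> #|e| = 2%N) ->
    #|parent_edges pi| = (n - #|fixed_set pi|)%N ->
    (s * #|NP| <= n * n)%N ->
    (\sum_(X : edge_set n | (X \subset NP :\: parent_edges pi) && (#|X| == j))
      #|supergraphs d (parent_edges pi :|: X)|)%:R
    <= N%:R * (C / n%:R) ^+ (n - #|fixed_set pi|) * delta.
  move=> NP2 pe NPs; rewrite natr_sum.
  apply: (@le_trans _ _ (\sum_(X : edge_set n |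
      (X \subset NP :\: parent_edges pi) && (#|X| == j))
      N%:R * (C / n%:R) ^+ (n - #|fixed_set pi|) * (C / n%:R) ^+ j)).
    apply: ler_sum => X /andP [XS /eqP Xj].
    have cY : #|parent_edges pi :|: X| = (n - #|fixed_set pi| + j)%N.
      rewrite cardsU pe Xj (_ : _ :&: _ = set0) ?cards0 ?subn0 //.
      apply/setP => e; rewrite !inE; apply/negP => /andP [ep eX].
      by have /setDP [_ /negP] := subsetP XS _ eX.
    rewrite -mulrA -exprD -cY; apply: card_supergraphs_real => //.
      move=> e /setUP [/card_in_parent_edges //|eX].
      by have /setDP [/NP2] := subsetP XS _ eX.
    by rewrite cY leq_add2r leq_subr.
  rewrite sumr_const -[leLHS]mulr_natl [leLHS]mulrC -[leLHS]mulrA.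
  apply: ler_wpM2l.
    by rewrite mulr_ge0 ?exprn_ge0.
  rewrite -cardsE cards_draws.
  have Tle : #|NP :\: parent_edges pi|%:R <= n%:R * n%:R / s%:R :> R.
    rewrite ler_pdivlMr // -!natrM ler_nat mulnC; apply: leq_trans NPs.
    by rewrite leq_mul2l subset_leq_card ?orbT // subsetDl.
  apply: le_trans (ler_wpM2l (exprn_ge0 _ q0) (bin_entropy R _ j0)) _.
  rewrite -exprMn; apply: lerXn2r.
  - by rewrite nnegrE mulr_ge0 // divr_ge0 ?mulr_ge0 ?expR_ge0.
  - by rewrite nnegrE divr_ge0 // !mulr_ge0 ?expR_ge0 ?ler0n.
  apply: (@le_trans _ _ (C / n%:R * (expR 1 * (n%:R * n%:R / s%:R) / j%:R))).
    apply: ler_wpM2l => //; apply: ler_wpM2r; first by rewrite invr_ge0 ltW.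
    by apply: ler_wpM2l => //; apply: expR_ge0.
  have -> : C / n%:R * (expR 1 * (n%:R * n%:R / s%:R) / j%:R) =
     (C * expR 1 / (s%:R * j%:R)) * n%:R.
    by field; rewrite !gt_eqF.
  have -> : 8 * expR 1 * C / s%:R = (C * expR 1 / (s%:R * j%:R)) * (8 * j%:R).
    by field; rewrite !gt_eqF.
  apply: ler_wpM2l => //.
  by rewrite divr_ge0 // mulr_ge0 ?expR_ge0 // ltW.
have bound : #|[set G in regular_graphs n d | compressible i0 near m s G]|%:R <=
    N%:R * (4 ^+ n * (1 + C) ^+ n * delta) :> R.
  have := compressible_le n d i0 near m s; rewrite -(ler_nat R) => /le_trans; apply.
  rewrite natr_sum.
  apply: (@le_trans _ _ (\sum_(pi : {ffun 'I_n -> 'I_n})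
     4 ^+ n * (N%:R * (C / n%:R) ^+ (n - #|fixed_set pi|) * delta))).
    rewrite big_mkcond; apply: ler_sum => pi _.
    set U := _ * _ * delta; have U0 : 0 <= U.
      by rewrite mulr_ge0 // mulr_ge0 ?ler0n // exprn_ge0.
    case: ifP => [/andP [piS /eqP pe]|_]; last by rewrite mulr_ge0 ?exprn_ge0.
    rewrite natr_sum.
    apply: (@le_trans _ _ (\sum_(phi in pffun_on i0 (mem (fixed_set pi)) (@predT I))
       2 ^+ n * U)).
      apply: ler_sum => phi _; rewrite natr_sum.
      apply: (@le_trans _ _ (\sum_(k : K) U)).
        rewrite big_mkcond; apply: ler_sum => k _; case: ifP => // NPs.
        by apply: XB => //; apply: card_in_pairs_of.
      rewrite sumr_const -[leLHS]mulr_natl; apply: ler_wpM2r => //.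
      rewrite -natrX ler_nat; apply: leq_trans KN _.
      apply: leq_trans (_ : (2 ^ m) ^ 2 <= _)%N; first by rewrite leq_exp2r.
      by rewrite -expnM leq_exp2l // mulnC.
    rewrite sumr_const -[leLHS]mulr_natl mulrA; apply: ler_wpM2r => //.
    rewrite (_ : 4 = 2 * 2) ?exprMn; last by rewrite -natrM.
    apply: ler_wpM2r; first by rewrite exprn_ge0.
    rewrite -natrX ler_nat card_pffun_on; apply: leq_trans (_ : (2 ^ m) ^ #|fixed_set pi| <= _)%N.
      by case: #|fixed_set pi| => // a; rewrite leq_exp2r.
    by rewrite -expnM leq_exp2l // mulnC.
  rewrite -big_distrr -mulrA mulrCA /=; apply: ler_wpM2l; first by rewrite exprn_ge0.
  rewrite -big_distrl -big_distrr /= -mulrA; apply: ler_wpM2l => //.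
  by apply: ler_wpM2r => //; apply: sum_parent_maps.
apply: le_trans bound _; rewrite mulrC; apply: ler_wpM2r => //.
have A0 : 0 < A by lra.
have dA : delta <= (A ^+ n)^-1.
  apply: (@le_trans _ _ ((A ^+ 8)^-1 ^+ j)).
    apply: lerXn2r; rewrite ?nnegrE ?invr_ge0 ?exprn_ge0 ?(ltW A0) //.
      by rewrite divr_ge0 // !mulr_ge0 ?expR_ge0 ?ler0n.
    by rewrite ler_pdivrMr // ler_pdivlMl ?exprn_gt0 // [leLHS]mulrC.
  rewrite exprVn -exprM lef_pV2 ?posrE ?exprn_gt0 //.
  by apply: ler_weXn2l; [lra|move: nj; rewrite -natrM ler_nat].
apply: le_trans (ler_wpM2l _ dA) _.
  by rewrite mulr_ge0 // exprn_ge0 //; lra.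
rewrite -exprMn -expr_div_n.
have -> : 4 * (1 + C) / A = 2^-1 by rewrite /A; field; rewrite gt_eqF //; lra.
rewrite exprVn lef_pV2 ?posrE ?exprn_gt0 // -natrX ler_nat.
exact/ltnW/ltn_expl.
Qed.

(** * Maps into metric spaces *)

Definition pseudometric (R : realType) (T : Type) (rho : T -> T -> R) : Prop :=
  [/\ forall x, rho x x = 0, forall x y, rho x y = rho y x &
      forall x y z, rho x z <= rho x y + rho y z].

Lemma pseudometric_ge0 (R : realType) (T : Type) (rho : T -> T -> R) x y :
  pseudometric rho -> 0 <= rho x y.
Proof.
by case=> r0 rs rt; have := rt x y x; rewrite r0 (rs y x); lra.
Qed.

(* The increment makes the weights positive, so that the distance to the root
   decreases strictly along parent pointers. *)
Definition weight (R : realType) (T : Type) (rho : T -> T -> R) n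
    (f : 'I_n -> T) (sigma : R) (u v : 'I_n) : nat :=
  (Num.truncn (rho (f u) (f v) / sigma)).+1.

(* Each edge is counted twice. *)
Definition dist_sum (R : realType) (T : Type) (rho : T -> T -> R) n
    (G : edge_set n) (f : 'I_n -> T) : R :=
  \sum_u \sum_v (adj G u v)%:R * rho (f u) (f v).

Lemma weight_gt (R : realType) (T : Type) (rho : T -> T -> R) n
    (f : 'I_n -> T) (sigma : R) (u v : 'I_n) : 0 < sigma ->
  rho (f u) (f v) < sigma * (weight rho f sigma u v)%:R.
Proof. by move=> s0; rewrite mulrC -ltr_pdivrMr // truncnS_gt. Qed.

Lemma weightC (R : realType) (T : Type) (rho : T -> T -> R) n
    (f : 'I_n -> T) (sigma : R) (u v : 'I_n) : pseudometric rho ->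
  weight rho f sigma u v = weight rho f sigma v u.
Proof. by case=> _ rs _; rewrite /weight rs. Qed.

(** Passing to integer weights adds at most 1 for each of the dn ordered edges. *)
Lemma sum_weight (R : realType) (T : Type) (rho : T -> T -> R) n d
    (G : edge_set n) (f : 'I_n -> T) (sigma : R) : pseudometric rho ->
  G \in regular_graphs n d -> 0 < sigma ->
  dist_sum rho G f <= sigma * (d * n)%:R ->
  (\sum_u \sum_v adj G u v * weight rho f sigma u v <= 2 * (d * n))%N.
Proof.
move=> rm Gr s0 H; rewrite -(ler_nat R) natr_sum.
apply: (@le_trans _ _ (\sum_u \sum_v (adj G u v)%:R *
    (rho (f u) (f v) / sigma + 1))).
  apply: ler_sum => u _; rewrite natr_sum; apply: ler_sum => v _.
  rewrite natrM; apply: ler_wpM2l => //.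
  by rewrite /weight -natr1 lerD2r truncn_le divr_ge0 ?(ltW s0) // pseudometric_ge0.
have -> : \sum_u \sum_v (adj G u v)%:R * (rho (f u) (f v) / sigma + 1) =
   dist_sum rho G f / sigma + (d * n)%:R.
  rewrite /dist_sum -(sum_adj_dn Gr) natr_sum big_distrl -big_split.
  apply: eq_bigr => u _ /=; rewrite natr_sum big_distrl -big_split.
  by apply: eq_bigr => v _ /=; rewrite mulrDr mulr1 mulrA.
rewrite mul2n -addnn natrD lerD2r ler_pdivrMr // mulrC; exact: H.
Qed.

(** The Poincare inequality for integer functions is applied to the truncated distance to [x] beyond
    radius r, in units of [sigma]. It vanishes on a fixed fraction of the vertices and varies along
    an edge by no more than its weight. The triangle inequality through [x] then bounds all
    pairs. *)
Lemma concentrated_bound (R : realType) (T : Type) (rho : T -> T -> R) n d q s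
    (G : edge_set n) (f : 'I_n -> T) (sigma r : R) x : pseudometric rho ->
  G \in regular_graphs n d -> expander q G -> 0 < sigma -> (0 < s)%N ->
  dist_sum rho G f <= sigma * (d * n)%:R ->
  (n <= s * #|[set v | (rho (f v) x <= r * sigma)%R]|)%N ->
  0 <= r ->
  \sum_u \sum_v rho (f u) (f v) <=
  n%:R ^+ 2 * (sigma * (2 * (2 * (d * q * s)%:R + 1 + r))).
Proof.
move=> rm Gr Ge s0 sn H xn r0; have [rxx rs rt] := rm.
pose g v := Num.truncn (rho (f v) x / sigma - r).
have gZ : (n <= s * #|[set v | g v == 0%N]|)%N.
  apply: leq_trans xn _; rewrite leq_mul2l subset_leq_card ?orbT //.
  apply/subsetP => v; rewrite !inE => vx; rewrite /g -leqn0 truncn_le_nat.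
  by rewrite -ler_pdivrMr // in vx; lra.
have gw u v : (g u - g v <= weight rho f sigma u v)%N.
  rewrite leq_subLR; have [->//|gu] := posnP (g u).
  have gu1 : 1 <= rho (f u) x / sigma - r by rewrite -truncn_gt0.
  have le1 : (g u)%:R <= rho (f u) x / sigma - r by rewrite truncn_le; lra.
  have lt2 : rho (f v) x / sigma - r < (g v).+1%:R by apply: truncnS_gt.
  have lt3 : rho (f u) (f v) / sigma < (weight rho f sigma u v)%:R.
    exact: truncnS_gt.
  have : rho (f u) x / sigma <= rho (f u) (f v) / sigma + rho (f v) x / sigma.
    by rewrite -mulrDl ler_pM2r ?invr_gt0.
  rewrite -ltnS -(ltr_nat R) -addSn natrD => tri; lra.
have gsum : (\sum_v g v <= 2 * (d * q * s) * n)%N.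
  apply: leq_trans (l1_poincare Ge sn gZ) _.
  apply: (@leq_trans (q * s * (2 * (d * n)))); last first.
    by rewrite leq_eqVlt; apply/orP; left; apply/eqP; ring.
  rewrite leq_mul2l; apply/orP; right; apply: leq_trans (sum_weight rm Gr s0 H).
  by apply: leq_sum => u _; apply: leq_sum => v _; rewrite leq_mul.
pose D := \sum_v rho (f v) x.
have DE : D <= n%:R * (sigma * (2 * (d * q * s)%:R + 1 + r)).
  apply: (@le_trans _ _ (\sum_v sigma * ((g v)%:R + (1 + r)))).
    apply: ler_sum => v _; rewrite mulrC -ler_pdivrMr //.
    have : rho (f v) x / sigma - r < (g v).+1%:R by apply: truncnS_gt.
    by rewrite -natr1; lra.
  rewrite -big_distrr /= mulrCA; apply: ler_wpM2l; first exact: ltW.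
  rewrite big_split /= sumr_const card_ord -[(1 + r) *+ n]mulr_natl.
  rewrite -natr_sum -[2 * _ + 1 + r]addrA [leRHS]mulrDr lerD2r -!natrM ler_nat.
  by rewrite mulnC.
apply: (@le_trans _ _ (\sum_(u < n) \sum_(v < n) (rho (f u) x + rho (f v) x))).
  apply: ler_sum => u _; apply: ler_sum => v _.
  by rewrite (rs (f v) x); apply: rt.
have -> : \sum_(u < n) \sum_(v < n) (rho (f u) x + rho (f v) x) = 2 * n%:R * D.
  under eq_bigr => u _ do rewrite big_split /= sumr_const card_ord -/D.
  by rewrite big_split /= sumr_const card_ord sumrMnl -/D -[D *+ n]mulr_natl; ring.
have n2 : 0 <= 2 * n%:R :> R by rewrite mulr_ge0.
apply: le_trans (ler_wpM2l n2 DE) _.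
by rewrite le_eqVlt; apply/orP; left; apply/eqP; ring.
Qed.

Lemma walk_dist (R : realType) (T : Type) (rho : T -> T -> R) n
    (G : edge_set n) (f : 'I_n -> T) (sigma : R) x v t : pseudometric rho ->
  0 < sigma -> walk G (weight rho f sigma) x v t ->
  rho (f x) (f v) <= sigma * t%:R.
Proof.
move=> [rxx rs rt] s0; elim=> [|u y r _ IH _]; first by rewrite rxx mulr0.
apply: le_trans (rt _ (f u) _) _; rewrite natrD mulrDr lerD //.
by apply/ltW/weight_gt.
Qed.

(** Region growing on the whole vertex set, which has no boundary and potential at most (2d+1)n; [p]
    is chosen so that division leaves n/s. *)
Lemma few_poor_vertices (R : realType) (T : Type) (rho : T -> T -> R) n d q s m L
    (G : edge_set n) (f : 'I_n -> T) (sigma : R) (p := (2 * q * (2 * d + 1) * s)%N) :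
  pseudometric rho -> G \in regular_graphs n d -> expander q G -> 0 < sigma ->
  (0 < q)%N ->
  dist_sum rho G f <= sigma * (d * n)%:R -> (2 * m <= n)%N ->
  (p ^ L * (1 + L * (d * m)) < p.+1 ^ L)%N ->
  (s * #|[set x | (#|wball G (weight rho f sigma) x L| < m)%N]| <= n)%N.
Proof.
move=> rm Gr Ge s0 q0 H mn growth.
have := poor_vertices_in setT Gr Ge
  (fun x => wball_center G (weight rho f sigma) x 0)
  (fun x => wball_family G (weight rho f sigma) x) mn growth.
have -> : boundary G setT = 0%N.
  by rewrite /boundary big1 // => u _; rewrite big1 // => v; rewrite !inE.
rewrite muln0 add0n (_ : [set x in setT | _] =
  [set x | (#|wball G (weight rho f sigma) x L| < m)%N]); last first.
  by apply/setP => x; rewrite !inE.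
set P := #|_|.
have pot : (potential G (weight rho f sigma) setT <= n + 2 * (d * n))%N.
  rewrite /potential cardsT card_ord leq_add2l.
  apply: leq_trans (sum_weight rm Gr s0 H).
  rewrite big_mkcond; apply: leq_sum => u _; rewrite in_setT big_mkcond.
  by apply: leq_sum => v _; rewrite in_setT.
move=> le1; have le2 := leq_trans le1 (leq_mul (leqnn q) (leq_mul (leqnn 2) pot)).
have c0 : (0 < 2 * q * (2 * d + 1))%N by rewrite !muln_gt0 q0 addn1.
rewrite -(leq_pmul2l c0) mulnA; apply: leq_trans le2 _.
by rewrite leq_eqVlt; apply/orP; left; apply/eqP; ring.
Qed.

Lemma rich_vertex (R : realType) (T : Type) (rho : T -> T -> R) n s m L
    (G : edge_set n) (f : 'I_n -> T) (sigma : R) :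
  (0 < n)%N -> (2 <= s)%N ->
  (s * #|[set x | (#|wball G (weight rho f sigma) x L| < m)%N]| <= n)%N ->
  exists x, (m <= #|wball G (weight rho f sigma) x L|)%N.
Proof.
move=> n0 s2 H; apply/existsP; apply: contraT => /existsPn nx.
move: H; rewrite (_ : [set x | _] = setT) ?cardsT ?card_ord.
  by move: n0 s2; clear; nia.
by apply/setP => x; rewrite [LHS]in_set in_setT ltnNge nx.
Qed.

Lemma wball_dist (R : realType) (T : Type) (rho : T -> T -> R) n
    (G : edge_set n) (f : 'I_n -> T) (sigma : R) x L : pseudometric rho -> 0 < sigma ->
  (#|wball G (weight rho f sigma) x L|
   <= #|[set v | (rho (f v) (f x) <= L%:R * sigma)%R]|)%N.
Proof.
move=> rm s0; apply/subset_leq_card/subsetP => v /wballP [t tL xv].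
have [_ rs _] := rm; rewrite inE rs (le_trans (walk_dist rm s0 xv)) // mulrC.
by rewrite ler_pM2r // ler_nat.
Qed.

(** The roots form a net of the vertices with large balls, and pointers follow shortest walks to it.
    Vertices with large balls are within 2L of a root, and the others are few. *)
Lemma forest (R : realType) (T : Type) (rho : T -> T -> R) n q s m L
    (G : edge_set n) (f : 'I_n -> T) (sigma : R) :
  pseudometric rho -> expander q G -> 0 < sigma -> (0 < n)%N -> (2 <= s)%N ->
  (s * #|[set x | (#|wball G (weight rho f sigma) x L| < m)%N]| <= n)%N ->
  exists pi : {ffun 'I_n -> 'I_n}, [/\ (#|fixed_set pi| * m <= n)%N,
    #|parent_edges pi| = (n - #|fixed_set pi|)%N, parent_edges pi \subset G,
    forall v, root_of pi v \in fixed_set pi &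
    (s * #|[set v | ~~ (rho (f v) (f (root_of pi v)) <= (2 * L)%:R * sigma)%R]|
      <= n)%N].
Proof.
move=> rm Ge s0 n0 s2 H; have [rxx rs rt] := rm.
set w := weight rho f sigma in H *.
have [x xr] := rich_vertex n0 s2 H.
have [S Sm Snet] := wball_net G m L (fun u v => weightC f sigma u v rm).
have S0 : S != set0 by have [y yS _] := Snet x xr; apply/set0Pn; exists y.
have [D [pi [piS piNS DS]]] := parents w Ge S0.
have wpos u v : (0 < w u v)%N by [].
have fixE : fixed_set pi = S.
  apply/setP => v; rewrite inE; apply/eqP/idP => [pv|/piS //].
  apply: contraT => /piNS [_]; rewrite pv; have := wpos v v; lia.
have Dlt v : v \notin S -> (D (pi v) < D v)%N.
  by move=> /piNS [_]; have := wpos (pi v) v; lia.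
(* Telescoping along the pointers: the distance in the target is controlled by the decrease of
   [D]. *)
have Ditr k v : rho (f v) (f (iter k pi v)) + sigma * (D (iter k pi v))%:R
    <= sigma * (D v)%:R.
  elim: k => [|k IH]; first by rewrite rxx add0r.
  apply: le_trans IH; rewrite iterS; set u := iter k pi v.
  have [uS|/piNS [_ Du]] := boolP (u \in S); first by rewrite piS.
  apply: le_trans (_ : rho (f v) (f u) + rho (f u) (f (pi u)) + sigma * (D (pi u))%:R <= _).
    by rewrite lerD2r; apply: rt.
  rewrite -addrA lerD2l rs; move: Du; rewrite -(ler_nat R) natrD => Du.
  have := weight_gt rho f (pi u) u s0; rewrite -/w => wl.
  have := ler_wpM2l (ltW s0) Du; rewrite mulrDr; lra.
have rootP v : exists2 z, z \in S & fconnect pi v z.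
  have : exists k, iter k pi v \in S.
    have [k] := ubnP (D v); elim: k v => // k IH v Dv.
    have [vS|vS] := boolP (v \in S); first by exists 0%N.
    have [|j jS] := IH (pi v); first by have := Dlt v vS; lia.
    by exists j.+1; rewrite iterSr.
  by case=> k kS; exists (iter k pi v) => //; apply: fconnect_iter.
have rootE v : root_of pi v \in S /\ fconnect pi v (root_of pi v).
  rewrite /root_of; case: pickP => [z /andP [ps vs]|none] /=.
    by split=> //; rewrite -fixE inE.
  have [z zS vs] := rootP v; have := none z.
  by rewrite vs piS // eqxx.
exists pi; split.
- by rewrite fixE.
- have cC := cardsC (fixed_set pi); rewrite card_ord in cC.
  rewrite -[X in _ = (X - _)%N]cC addKn; apply: card_in_imset => u v.
  (* Two vertices with the same parent edge would be each other's parents, against the strict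
     decrease of [D]; so there are as many parent edges as non-roots. *)
  rewrite fixE !in_setC => uS vS /eqP; rewrite set2_eq.
  case/orP => /andP [/eqP uv /eqP pv] //.
  by have := Dlt u uS; have := Dlt v vS; rewrite pv -uv; lia.
- apply/subsetP => e /imsetP [v vS ->]; rewrite fixE in_setC in vS.
  by rewrite -/(adj G v (pi v)) adjC; have [] := piNS v vS.
- by move=> v; rewrite fixE; have [] := rootE v.
- apply: leq_trans H; rewrite leq_mul2l subset_leq_card ?orbT //.
  apply/subsetP => v; rewrite !inE; apply: contraR; rewrite -leqNgt => vr.
  have [t tS vt] := Snet v vr; have Dv := DS _ _ _ tS vt.
  have [_ /iter_findex E] := rootE v.
  have := Ditr (findex pi v (root_of pi v)) v; rewrite E => le1.
  have ge0 : 0 <= sigma * (D (root_of pi v))%:R by rewrite mulr_ge0 // ltW.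
  apply: le_trans (_ : sigma * (D v)%:R <= _); first lra.
  by rewrite mulrC ler_pM2r // ler_nat.
Qed.

Definition near_metric (R : realType) (T : Type) (rho : T -> T -> R)
    (I : finType) (e : I -> T) (k : I * I) : rel I :=
  fun i j => rho (e i) (e j) <= rho (e k.1) (e k.2).

(* Only the distances that occur matter as thresholds, so that the union bound
   runs over at most #|I| ^ 2 of them. *)
Lemma near_metric_threshold (R : realType) (T : Type) (rho : T -> T -> R)
    (I : finType) (e : I -> T) (i0 : I) (theta : R) :
  pseudometric rho -> 0 <= theta ->
  exists k, forall i j, near_metric rho e k i j = (rho (e i) (e j) <= theta).
Proof.
move=> [rxx _ _] t0; pose F (k : I * I) := rho (e k.1) (e k.2).
have P0 : F (i0, i0) <= theta by rewrite /F rxx.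
case: (@Order.TotalTheory.arg_maxP _ _ _ (i0, i0) (fun k => F k <= theta) F P0).
move=> k Pk kmax; exists k => i j; apply/idP/idP.
  by move=> /le_trans; apply.
by move=> /(kmax (i, j)).
Qed.

Lemma card_pairs_of_le n s (r : rel 'I_n) :
  (forall u, s * #|[set v | r u v]| <= n)%N ->
  (s * #|pairs_of r| <= n * n)%N.
Proof.
move=> H; apply: (@leq_trans (s * \sum_u #|[set v | r u v]|)).
  rewrite leq_mul2l card_pairs; apply/orP; right.
  apply: leq_trans (leq_imset_card (fun p => [set p.1; p.2]) _).
  apply/subset_leq_card/subsetP => x; rewrite inE.
  case/existsP => u /existsP [v /and3P [_ /eqP -> uv]].
  by apply/imsetP; exists (u, v); rewrite ?inE.
rewrite big_distrr -[X in (_ <= X * _)%N]card_ord -sum_nat_const.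
by apply: leq_sum => u _; apply: H.
Qed.

(** An edge of weight at most L between vertices within 2L of their roots puts the root values
    within 2L + L + 2L = 5L, the threshold for near. Conversely, a vertex near u in this sense and
    within 2L of its root has its value within 7L of the root value of u, which few vertices do. *)
Lemma spread_compressible (R : realType) (T : Type) (rho : T -> T -> R) n d s s' m L
    (G : edge_set n) (f : 'I_n -> T) (sigma : R)
    (I : finType) (e : I -> T) (code : T -> I) (i0 : I)
    (pi : {ffun 'I_n -> 'I_n}) :
  pseudometric rho -> G \in regular_graphs n d -> (3 <= d)%N -> 0 < sigma ->
  dist_sum rho G f <= sigma * (d * n)%:R -> (forall x, e (code x) = x) ->
  (16 * d <= s')%N -> (2 * s <= s')%N -> (16 * d <= L)%N ->
  (#|fixed_set pi| * m <= n)%N -> #|parent_edges pi| = (n - #|fixed_set pi|)%N ->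
  parent_edges pi \subset G -> (forall v, root_of pi v \in fixed_set pi) ->
  (s' * #|[set v | ~~ (rho (f v) (f (root_of pi v)) <= (2 * L)%:R * sigma)%R]|
     <= n)%N ->
  (forall x, s' * #|[set v | (rho (f v) x <= (7 * L)%:R * sigma)%R]| <= n)%N ->
  compressible i0 (near_metric rho e) m s G.
Proof.
move=> rm Gr d3 s0 H eK s'd s's Ld piS pe peG rootP far spread.
have [rxx rs rt] := rm; set Z := [set v | ~~ _] in far.
have closeZ v : v \notin Z -> rho (f v) (f (root_of pi v)) <= (2 * L)%:R * sigma.
  by rewrite inE negbK.
have [k kP] : exists k, forall i j, near_metric rho e k i j =
    (rho (e i) (e j) <= (5 * L)%:R * sigma).
  by apply: near_metric_threshold => //; rewrite mulr_ge0 // ltW.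
pose phi := [ffun v => if pi v == v then code (f v) else i0].
pose r := fun u v => near_metric rho e k (phi (root_of pi u)) (phi (root_of pi v)).
have rE u v : r u v =
    (rho (f (root_of pi u)) (f (root_of pi v)) <= (5 * L)%:R * sigma).
  have := rootP u; have := rootP v; rewrite !in_set => pv pu.
  by rewrite /r /phi !ffunE pu pv kP !eK.
apply/existsP; exists pi; apply/existsP; exists phi; apply/existsP; exists k.
rewrite /code_of -/r; apply/and5P; split=> //; last (apply/andP; split).
- apply/pffun_onP; split=> //; apply/subsetP => v; rewrite !inE /phi ffunE.
  by case: ifP => //; rewrite eqxx.
- by rewrite pe.
- apply: card_pairs_of_le => u.
  set W := [set v | (rho (f v) (f (root_of pi u)) <= (7 * L)%:R * sigma)%R].
  have sub : (#|[set v | r u v]| <= #|Z| + #|W|)%N.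
    apply: leq_trans (leq_card_setU _ _); apply/subset_leq_card/subsetP => v.
    rewrite in_setU [v \in [set _ | _]]in_set rE => uv; apply/orP.
    have [|/closeZ vZ] := boolP (v \in Z); [by left|right].
    rewrite inE; apply: le_trans (rt _ (f (root_of pi v)) _) _.
    rewrite (rs (f (root_of pi v))) !natrM in uv vZ *; lra.
  have := spread (f (root_of pi u)); rewrite -/W => Wn.
  move: far Wn sub s's; move: #|Z| #|W| #|_| => z w c; clear; nia.
set NP := pairs_of r.
have cG := card_edges Gr; have := cardsID NP G.
have := subset_leq_card (subsetIr (G :&: NP) (parent_edges pi)).
have := cardsID (parent_edges pi) (G :&: NP).
have Y2 : forall x, x \in G :\: NP -> #|x| = 2%N.
  by move=> x /setDP [xG _]; have [+ _] := regularP Gr; apply.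
set w := weight rho f sigma.
(* Markov's inequality: since L >= 16d, at most n/8 ordered edges are long. *)
have Lw : (L * \sum_u \sum_v (adj G u v && (L < w u v)) <= 2 * (d * n))%N.
  apply: leq_trans (sum_weight rm Gr s0 H).
  rewrite big_distrr; apply: leq_sum => u _ /=.
  rewrite big_distrr; apply: leq_sum => v _ /=; rewrite -/w.
  by case: (adj G u v); case: (ltnP L (w u v)) => //; rewrite ?muln0 //= muln1 mul1n => /ltnW.
have Zsum : (\sum_u \sum_v ((u \in Z) && adj G u v) = d * #|Z|)%N.
  rewrite mulnC -sum_nat_const [RHS]big_mkcond; apply: eq_bigr => u _.
  by case: (u \in Z) => /=; [apply: sum_adj|rewrite big1].
have Zsum' : (\sum_u \sum_v ((v \in Z) && adj G u v) = d * #|Z|)%N.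
  rewrite exchange_big -Zsum; apply: eq_bigr => u _; apply: eq_bigr => v _.
  by rewrite adjC.
have Ysum : (2 * #|G :\: NP| <= d * #|Z| + d * #|Z| +
    \sum_u \sum_v (adj G u v && (L < w u v)))%N.
  rewrite -(sum_adj_simple Y2) -{1}Zsum -Zsum' -!big_split.
  apply: leq_sum => u _ /=; rewrite -!big_split; apply: leq_sum => v _ /=.
  have [uvY|//] := boolP (adj (G :\: NP) u v).
  move: uvY; rewrite /adj in_setD -/(adj G u v) => /andP [uvNP uv].
  rewrite uv !andbT /=; have [//|/closeZ uZ] := boolP (u \in Z).
  have [//|/closeZ vZ] := boolP (v \in Z).
  have [//|wL] := ltnP L (w u v); exfalso; case/negP: uvNP.
  rewrite inE; apply/existsP; exists u; apply/existsP; exists v.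
  rewrite eqxx (adj_irr Gr uv) rE /=.
  have := rt (f (root_of pi u)) (f u) (f (root_of pi v)).
  have := rt (f u) (f v) (f (root_of pi v)); rewrite (rs _ (f u)).
  have := weight_gt rho f u v s0; rewrite -/w.
  have : sigma * (w u v)%:R <= sigma * L%:R.
    by apply: ler_wpM2l; rewrite ?ler_nat // ltW.
  move: uZ vZ; rewrite !natrM; lra.
move: Ysum Lw far cG s'd Ld; rewrite pe.
move: (\sum_u _)%N => c.
have : (3 * n <= d * n)%N by rewrite leq_mul2r d3 orbT.
have : (#|G :&: NP :&: parent_edges pi| <= n)%N -> True by [].
move: d3.
set z := #|Z|; set g := #|G|; set y := #|G :\: NP|; set gn := #|G :&: NP|.
set a := #|G :&: NP :&: parent_edges pi|; set b := #|_ :\: parent_edges pi|.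
clearbody z g y gn a b; clear.
move=> d3 _ dn Y Lw far cG s'd Ld e1 e2 e3.
(* Vertices far from their roots and long edges account for at most n/8 edges that are not near. Of
   the dn/2 >= 3n/2 edges, at most n are parent edges, so at least 3n/8 near ones remain. *)
have h1 : (16 * d * z <= n)%N by apply: leq_trans far; rewrite leq_mul2r s'd orbT.
have h2 : (8 * c <= n)%N.
  have d0 : (0 < 2 * d)%N by lia.
  rewrite -(leq_pmul2l d0) mulnA; apply: leq_trans (leq_trans _ Lw) _.
    by rewrite leq_mul2r; apply/orP; right; lia.
  by lia.
have h3 : (16 * (d * z) <= n)%N by rewrite mulnA.
move: Y h2 h3 e1 e2 e3 dn cG; move: (d * z)%N (d * n)%N; clear; lia.
Qed.

(** * Conclusion *)

(** Ensures ln 3 > 1, so that ln ln N is positive from N = 3 on. The proof uses 1/e >= (5/6)^6 >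
    1/3. *)
Lemma expR1_lt3 (R : realType) : expR 1 < 3 :> R.
Proof.
have : (5 / 6) ^+ 6 <= expR (- (1 / 6)) ^+ 6 :> R.
  apply: lerXn2r; rewrite ?nnegrE ?expR_ge0 //.
  by apply: le_trans (expR_ge1Dx _); lra.
rewrite -expRM_natl (_ : 6 * - (1 / 6) = - 1 :> R); last by field.
rewrite expRN => H; rewrite -ltf_pV2 ?posrE ?expR_gt0 //.
by apply: lt_le_trans H; rewrite !exprS expr0; lra.
Qed.

Lemma ln2_ge (R : realType) : 1 / 2 <= ln 2 :> R.
Proof.
rewrite -ler_expR lnK ?posrE //.
have : (1 / 2) * expR (1 / 2) <= expR (- (1 / 2)) * expR (1 / 2) :> R.
  apply: ler_wpM2r; first exact: expR_ge0.
  by apply: le_trans (expR_ge1Dx _); lra.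
by rewrite -expRD addNr expR0; lra.
Qed.

Lemma up_log_ln (R : realType) (m : nat) : (2 <= m)%N ->
  (up_log 2 m)%:R <= 1 + 2 * ln m%:R :> R.
Proof.
move=> m2; have /andP [le1 _] := up_log_bounds (ltnSn 1) m2.
have {}le1 : ((up_log 2 m).-1)%:R * ln 2 <= ln m%:R :> R.
  rewrite mulr_natl -lnXn // -natrX ler_ln ?posrE ?ltr0n ?expn_gt0 ?ler_nat //; last lia.
  exact: ltnW.
have u0 : (0 < up_log 2 m)%N by rewrite up_log_gt0.
rewrite -[X in X%:R <= 1 + _](prednK u0) -natr1.
have : 0 <= ((up_log 2 m).-1)%:R * (ln 2 - 1 / 2) :> R.
  by rewrite mulr_ge0 // subr_ge0 ln2_ge.
by move: le1; move: (_.-1%:R : R) => x; lra.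
Qed.

(** From m <= 3 ln N one gets ln m <= ln 3 + ln ln N; the additive ln 3 is absorbed because ln ln N
    is at least [kappa] = ln ln 3 > 0. *)
Lemma log_log_bound (R : realType) : exists2 c : R, 0 < c &
  forall N n m : nat, (3 <= N)%N -> (2 <= m)%N -> (m <= up_log 2 N)%N ->
  (m <= n)%N ->
  (up_log 2 m)%:R <= c * Num.min (ln n%:R) (ln (ln N%:R)) :> R.
Proof.
have ln3 : 1 < ln 3 :> R by rewrite -ltr_expR lnK ?posrE // expR1_lt3.
pose kappa : R := ln (ln 3); have k0 : 0 < kappa by rewrite ln_gt0.
have r0 : 0 <= ln 3 / kappa by rewrite divr_ge0 // ltW //; lra.
exists (4 * (1 + ln 3 / kappa)); first lra.
move=> N n m N3 m2 mN mn.
have m0 : 0 < m%:R :> R by rewrite ltr0n; lia.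
have lm2 : ln 2 <= ln m%:R :> R by rewrite ler_ln ?posrE // ler_nat.
have l4 : (up_log 2 m)%:R <= 4 * ln m%:R :> R.
  by have := up_log_ln R m2; have := ln2_ge R; lra.
have lN3 : ln 3 <= ln N%:R :> R by rewrite ler_ln ?posrE ?ltr0n ?ler_nat //; lia.
have llN : kappa <= ln (ln N%:R) by rewrite ler_ln ?posrE //; lra.
have lmn : ln m%:R <= ln n%:R :> R by rewrite ler_ln ?posrE ?ltr0n ?ler_nat //; lia.
have lmN : ln m%:R <= (1 + ln 3 / kappa) * ln (ln N%:R) :> R.
  have h1 : m%:R <= 3 * ln N%:R :> R.
    apply: (@le_trans _ _ (up_log 2 N)%:R); first by rewrite ler_nat.
    by apply: le_trans (up_log_ln R _) _; [lia|lra].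
  have h2 : ln m%:R <= ln 3 + ln (ln N%:R) :> R.
    by rewrite -lnM ?posrE ?ler_ln ?posrE //; lra.
  have h3 : ln 3 <= ln 3 / kappa * ln (ln N%:R) :> R.
    by rewrite -{1}(divfK (lt0r_neq0 k0) (ln 3)) ler_wpM2l.
  lra.
have lm0 : 0 <= ln m%:R :> R by have := ln2_ge R; lra.
apply: le_trans l4 _; rewrite -mulrA ler_pM2l //.
have c0 : 0 <= 1 + ln 3 / kappa by lra.
have ln0 : 0 <= ln n%:R :> R by lra.
rewrite minr_pMr //.
rewrite le_min lmN andbT; apply: le_trans lmn _.
by apply: ler_peMl; lra.
Qed.

(** * Reduction to maps of bounded average edge length *)

Lemma dist_sum_edges (R : realType) (M : metricType R) n d (G : edge_set n)
    (f : 'I_n -> M) : G \in regular_graphs n d ->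
  dist_sum mdist G f = 2 * edge_dist_sum G f.
Proof.
move=> Gr; rewrite /edge_dist_sum.
have E : \sum_(v < n) \sum_(u < n | (v < u)%N && ([set v; u] \in G))
    mdist (f v) (f u) =
    \sum_(v < n) \sum_(u < n) ((v < u)%N && adj G v u)%:R * mdist (f v) (f u).
  apply: eq_bigr => v _; rewrite big_mkcond; apply: eq_bigr => u _.
  by rewrite /adj; case: ifP => _; rewrite ?mul1r ?mul0r.
rewrite E mulr2n mulrDl mul1r {2}exchange_big -big_split; apply: eq_bigr => u _ /=.
rewrite -big_split; apply: eq_bigr => v _ /=.
rewrite (adjC G v u) (metric_sym (f v)) -mulrDl; congr (_ * _).
have [uv|_] := boolP (adj G u v); last by rewrite !andbF addr0.
rewrite !andbT; case: ltngtP => // [||E']; rewrite ?addr0 ?add0r //.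
by have := adj_irr Gr uv; rewrite (val_inj E') eqxx.
Qed.

Lemma mdist_pseudometric (R : realType) (M : metricType R) :
  pseudometric (@mdist R M).
Proof.
by split; [exact: mdistxx|exact: metric_sym|exact: metric_triangle].
Qed.

Lemma poincare_const_le (R : realType) (M : metricType R) n d (G : edge_set n)
    (g : R) : (0 < d * n)%N -> G \in regular_graphs n d -> 0 < g ->
  (forall (f : 'I_n -> M) sigma, 0 < sigma ->
     dist_sum mdist G f <= sigma * (d * n)%:R -> mean_pair_dist f <= g * sigma) ->
  (poincare_const M G <= g%:E)%E.
Proof.
move=> dn Gr g0 H; apply: ereal_inf_lbound; exists g => //=; split=> // f.
have dnR : 0 < (d * n)%:R :> R by rewrite ltr0n.
have G0 : #|G|%:R = (d * n)%:R / 2 :> R.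
  by rewrite -(card_edges Gr) natrM; field.
have W0 : 0 <= edge_dist_sum G f.
  by apply: sumr_ge0 => u _; apply: sumr_ge0 => v _; apply: mdist_ge0.
rewrite G0 -mulrA [((d * n)%:R / 2)^-1 * _]mulrC.
set W := edge_dist_sum G f / _; have W'0 : 0 <= W by rewrite !divr_ge0 // ltW.
have HW sigma : 0 < sigma -> W <= sigma -> mean_pair_dist f <= g * sigma.
  move=> s0 Ws; apply: H => //; rewrite (dist_sum_edges _ Gr).
  by move: Ws; rewrite /W ler_pdivrMr ?divr_gt0 //; lra.
have [W1|/esym W1] : (0 < W) \/ (0 = W) by move: W'0; rewrite le_eqVlt => /orP [/eqP|]; auto.
  exact: HW.
rewrite W1 mulr0 leNgt; apply/negP; move: (mean_pair_dist f) HW => a HW a0.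
(* If all edge lengths vanish, every positive sigma is allowed; this choice gives a <= a/2, which
   contradicts a > 0. *)
have s0 : 0 < a / (2 * g) by rewrite divr_gt0 // mulr_gt0.
have := HW _ s0; rewrite W1 => /(_ (ltW s0)).
have -> : g * (a / (2 * g)) = a / 2 by field; rewrite gt_eqF.
lra.
Qed.

(** [s'] is large enough both for the count of near edges (16d) and for that of near pairs (2s). If
    n <= 4m, one ball with m vertices is already a fixed fraction of the graph. *)
Lemma concentrated_or_compressible (R : realType) (T : Type) (rho : T -> T -> R)
    n d q s m L (G : edge_set n) (f : 'I_n -> T) (sigma : R)
    (I : finType) (e : I -> T) (code : T -> I) (i0 : I)
    (s' := (16 * d + 2 * s)%N) (p := (2 * q * (2 * d + 1) * s')%N) :
  pseudometric rho -> G \in regular_graphs n d -> expander q G ->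
  (3 <= d)%N -> (0 < q)%N -> 0 < sigma ->
  dist_sum rho G f <= sigma * (d * n)%:R -> (forall x, e (code x) = x) ->
  (16 * d <= L)%N -> (0 < m)%N -> (2 * m <= n)%N ->
  (p ^ L * (1 + L * (d * m)) < p.+1 ^ L)%N ->
  (n <= 4 * m)%N \/ ~~ compressible i0 (near_metric rho e) m s G ->
  exists x, (n <= s' * #|[set v | (rho (f v) x <= (7 * L)%:R * sigma)%R]|)%N.
Proof.
move=> rm Gr Ge d3 q0 s0 H eK Ld m0 mn growth alt.
have n0 : (0 < n)%N by lia.
have s'2 : (2 <= s')%N by rewrite /s'; lia.
have poor := few_poor_vertices rm Gr Ge s0 q0 H mn growth.
have [[x xn]|none] := pselect (exists x,
    (n <= s' * #|[set v | (rho (f v) x <= (7 * L)%:R * sigma)%R]|)%N).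
  by exists x.
have spread x : (s' * #|[set v | (rho (f v) x <= (7 * L)%:R * sigma)%R]| <= n)%N.
  by rewrite leqNgt; apply/negP => /ltnW xn; apply: none; exists x.
case: alt => [n4m|ncomp].
  have [x xr] := rich_vertex n0 s'2 poor; exists (f x).
  have := wball_dist G f x L rm s0.
  set W := #|[set v | (rho (f v) (f x) <= L%:R * sigma)%R]| => xW.
  apply: (@leq_trans (s' * W)).
    apply: leq_trans n4m _; rewrite leq_mul //; first by rewrite /s'; lia.
    exact: leq_trans xr xW.
  rewrite leq_mul2l subset_leq_card ?orbT //; apply/subsetP => v.
  rewrite !inE => /le_trans; apply; rewrite ler_pM2r // ler_nat; lia.
have [pi [piS pe peG rootP far]] := forest rm Ge s0 n0 s'2 poor.
case/negP: ncomp; apply: spread_compressible rm Gr d3 s0 H eK _ _ Ld piS pe peG rootP far spread.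
  by rewrite leq_addr.
by rewrite leq_addl.
Qed.

Lemma finite_enumeration (R : realType) (M : metricType R) (N : nat) :
  ([set: M] #= `I_N)%card -> exists (e : 'I_N -> M) (code : M -> 'I_N),
  forall x, e (code x) = x.
Proof.
case/card_set_bijP => g [gN ginj gsurj].
have surj (i : 'I_N) : exists x : M, g x = i.
  by have [x _ <-] := gsurj i (ltn_ord i); exists x.
have [e eP] := choice surj; exists e, (fun x => Ordinal (gN x I)) => x.
by apply: ginj; rewrite ?in_setE // eP.
Qed.

Lemma regular_graph_prob_ge (R : realType) n d (P : pred (edge_set n))
    (X1 X2 : {set edge_set n}) (a b : R) :
  regular_graphs n d != set0 ->
  #|X1|%:R <= a * #|regular_graphs n d|%:R ->
  #|X2|%:R <= b * #|regular_graphs n d|%:R ->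
  (forall G, G \in regular_graphs n d -> G \notin X1 -> G \notin X2 -> P G) ->
  1 - (a + b) <= regular_graph_prob R d P.
Proof.
move=> reg0 H1 H2 HP; rewrite /regular_graph_prob.
have r0 : 0 < #|regular_graphs n d|%:R :> R by rewrite ltr0n card_gt0.
rewrite ler_pdivlMr // mulrBl mul1r mulrDl.
have : (#|regular_graphs n d| <= #|[set G in regular_graphs n d | P G]| + #|X1| + #|X2|)%N.
  apply: leq_trans (leq_trans (leq_card_setU _ _) (leq_add (leq_card_setU _ X1) (leqnn #|X2|))).
  apply/subset_leq_card/subsetP => G Gr; rewrite !in_setU in_set Gr /=.
  have [//|G1] := boolP (G \in X1); first by rewrite orbT.
  have [|G2] := boolP (G \in X2); first by rewrite !orbT.
  by rewrite HP.
rewrite -(ler_nat R) !natrD; lra.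
Qed.

(** Concentration at radius 7L with L = pkl bounds the mean distance by 2(2dqs' + 1 + 7L) sigma, and
    L >= 1 lets L be factored out. *)
Lemma poincare_const_good (R : realType) (M : metricType R) n d q s m k l
    (G : edge_set n) (I : finType) (e : I -> M) (code : M -> I) (i0 : I)
    (s' := (16 * d + 2 * s)%N) (p := (2 * q * (2 * d + 1) * s')%N)
    (g : R) :
  G \in regular_graphs n d -> expander q G -> (3 <= d)%N -> (0 < q)%N ->
  (0 < k)%N -> (0 < l)%N ->
  (forall x, e (code x) = x) -> (0 < m)%N -> (2 * m <= n)%N ->
  (p ^ (p * k * l) * (1 + p * k * l * (d * m)) < p.+1 ^ (p * k * l))%N ->
  (n <= 4 * m)%N \/ ~~ compressible i0 (near_metric mdist e) m s G ->
  2 * (2 * (d * q * s')%:R + 8) * (p * k)%:R * l%:R <= g ->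
  (poincare_const M G <= g%:E)%E.
Proof.
move=> Gr Ge d3 q0 k0 l0 eK m0 mn growth alt gE.
have n0 : (0 < n)%N by lia.
have s'0 : (0 < s')%N by rewrite /s'; lia.
have p0 : (s' <= p)%N by rewrite leq_pmull // !muln_gt0 q0 addn1.
have L0 : (p <= p * k * l)%N by rewrite -mulnA leq_pmulr // muln_gt0 k0.
have g0 : 0 < g.
  have pk : (0 < p * k)%N by rewrite muln_gt0 k0 (leq_trans s'0).
  have c8 : 0 < 2 * (d * q * s')%:R + 8 :> R by rewrite ltr_wpDl ?mulr_ge0.
  by apply: lt_le_trans gE; rewrite !mulr_gt0 ?ltr0n.
apply: (poincare_const_le _ Gr) => //; first by rewrite muln_gt0 n0; lia.
move=> f sigma s0 H; have rm := mdist_pseudometric M.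
have Ld : (16 * d <= p * k * l)%N.
  by apply: leq_trans L0; apply: leq_trans p0; rewrite leq_addr.
have [x xn] := concentrated_or_compressible rm Gr Ge d3 q0 s0 H eK Ld m0 mn growth alt.
have conc := concentrated_bound rm Gr Ge s0 s'0 H xn (ler0n _ _).
have n2 : 0 < n%:R ^+ 2 :> R by rewrite exprn_gt0 // ltr0n.
rewrite /mean_pair_dist [leLHS]mulrC ler_pdivrMr //; apply: le_trans conc _.
rewrite [leLHS]mulrC ler_pM2r // [leRHS]mulrC ler_pM2l //; apply: le_trans gE.
have L1 : 1 <= (p * k * l)%:R :> R.
  by rewrite ler1n (leq_trans _ L0) // (leq_trans s'0).
rewrite -[leRHS]mulrA -[(p * k)%:R * _]natrM (natrM _ 7).
have c0 : 0 <= (d * q * s')%:R :> R by rewrite ler0n.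
move: (p * k * l)%:R (d * q * s')%:R L1 c0 => L c L1 c0.
have : 0 <= c * (L - 1) by rewrite mulr_ge0 // subr_ge0.
rewrite mulrBr mulr1; lra.
Qed.

Local Open Scope classical_set_scope.
Local Open Scope card_scope.
Local Open Scope ring_scope.

Theorem theorem1p5 (R : realType) (d : nat) (hd : (3 <= d)%N) :
  exists C tau B : R, [/\ 1 <= C, 0 < tau, 0 < B &
    forall (M : metricType R) (N : nat),
      [set: M] #= `I_N -> (3 <= N)%N ->
    forall n : nat, (d <= n)%N -> ~~ odd (d * n) ->
      regular_graphs n d != finset.set0 ->
      regular_graph_prob R d (fun G : edge_set n =>
        (poincare_const M G
           <= (C * Num.min (ln n%:R) (ln (ln N%:R)))%:E)%E)
      >= 1 - B / (n%:R `^ tau)].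
Proof.
have [q [B1 [q0 B10 nonexp]]] := nonexpanders_rare R hd.
have [s s0 comp] := compressible_rare R hd.
pose s' := (16 * d + 2 * s)%N; pose p := (2 * q * (2 * d + 1) * s')%N.
have p0 : (0 < p)%N.
  by rewrite !muln_gt0 q0 addn1 addn_gt0 muln_gt0 (leq_trans _ hd).
have [k k0 growth] := growth_radius d p0.
have [c c0 llb] := log_log_bound R.
pose A : R := 2 * (2 * (d * q * s')%:R + 8) * (p * k)%:R.
have A0 : 0 <= A by rewrite !mulr_ge0 ?addr_ge0 ?mulr_ge0.
pose n0 := (16 * (d * d) + 8)%N.
(* The summands of B pay for the non-expanders, for the compressible graphs, and for n < [n0], where
   the claimed lower bound is not positive. *)
exists (1 + A * c), 1, (B1 + 1 + n0%:R); split=> //.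
- by rewrite lerDl mulr_ge0 // ltW.
- by rewrite -addrA addr_gt0 // ltr_wpDr.
move=> M N MN N3 n dn _ reg0.
have nR : 0 < n%:R :> R by rewrite ltr0n; lia.
rewrite powRr1 ?(ltW nR) //; have [nn0|n0n] := ltnP n n0.
  apply: (@le_trans _ _ 0); last by rewrite divr_ge0.
  rewrite subr_le0 ler_pdivlMr // mul1r; apply: (@le_trans _ _ n0%:R).
    by rewrite ler_nat ltnW.
  by rewrite lerDr addr_ge0 // ltW.
have [e [code eK]] := finite_enumeration MN.
have N0 : (0 < N)%N by lia.
(* When m = u, the points number at most 2^m, as the union bound requires; the cap n/2 is imposed by
   region growing. *)
pose i0 := Ordinal N0; pose u := up_log 2 N; pose m := minn u n./2.
have NU : (N <= 2 ^ u)%N by apply: up_logP.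
have u2 : (2 <= u)%N.
  rewrite leqNgt; apply/negP => u1; move: N3; rewrite leqNgt ltnS.
  by rewrite (leq_trans NU) // -[2%N in leqRHS]expn1 leq_exp2l // -ltnS.
have n20 : (20 <= n)%N 
  by have := leq_mul hd hd; move: n0n; rewrite /n0; clear; lia.
have m2 : (2 <= m)%N by rewrite leq_min u2 /=; move: n20; clear; lia.
have mn : (2 * m <= n)%N by rewrite /m; clear; lia.
have l0 : (0 < up_log 2 m)%N by rewrite up_log_gt0.
have lE : (up_log 2 m)%:R <= c * Num.min (ln n%:R) (ln (ln N%:R)) :> R.
  by apply: llb => //; [rewrite geq_minl|move: mn; clear; lia].
set g := Num.min _ _ in lE *.
have g0 : 0 <= g by rewrite -(pmulr_rge0 _ c0); apply: le_trans lE.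
have gE : A * (up_log 2 m)%:R <= (1 + A * c) * g.
  rewrite mulrDl mul1r -mulrA; apply: le_trans (ler_wpM2l A0 lE) _.
  by rewrite lerDr.
have gr := growth _ _ l0 (up_logP m (ltnSn 1)).
(* If u exceeds n/2, then m is n/2 rounded down and n <= 4m, so no compressible graphs have to be
   discarded. *)
pose X2 : {set edge_set n} := if (u <= n./2)%N then
  [set G in regular_graphs n d |
    compressible i0 (near_metric mdist e) m s G]%SET else finset.set0.
have n0n' : (8 + 16 * (d * d) <= n)%N by rewrite addnC.
have X2E : #|X2|%:R <= n%:R^-1 * #|regular_graphs n d|%:R :> R.
  rewrite /X2; case: leqP => [um|_]; last by rewrite cards0 mulr_ge0 ?invr_ge0.
  apply: comp => //; last by rewrite card_prod mulnn.
  by rewrite card_ord /m (minn_idPl um).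
apply: le_trans (regular_graph_prob_ge (P := fun G => _) reg0 (nonexp n n0n) X2E _).
  by rewrite lerD2l lerN2 2!mulrDl mul1r lerDl divr_ge0.
move=> G Gr GX1 GX2; apply: (poincare_const_good (i0 := i0) Gr _ hd q0 k0 l0 eK
  (ltnW m2) mn gr _ gE).
  by move: GX1; rewrite inE Gr /= negbK => /asboolP.
move: GX2; rewrite /X2; case: leqP => [um|um _].
  by rewrite finset.in_set Gr; right.
by left; rewrite /m (minn_idPr (ltnW um)); move: n20; clear; lia.
Qed.
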